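(* Let $X$ be a simple abelian surface over $\mathbb{C}$. Then the fixed-points function $n\mapsto\#\mathrm{Fix}(f^n)$ of any non-zero endomorphism $f\in\mathrm{End}(X)$ either grows exponentially (B1) or is periodic (B2), but never has behaviour (B3). Specifically, for non-zero $f\in\mathrm{End}(X)$: (a) Suppose that $X$ has real multiplication, i.e., $\mathrm{End}_{\mathbb{Q}}(X)=\mathbb{Q}(\sqrt d)$ for a square-free integer $d>0$. Then $\#\mathrm{Fix}(f^n)$ is periodic if $f=\pm\mathrm{id}_X$, and it grows exponentially otherwise. (b) Suppose that $X$ has indefinite quaternion multiplication, i.e., $\mathrm{End}_{\mathbb{Q}}(X)$ is of the form $\mathbb{Q}+i\mathbb{Q}+j\mathbb{Q}+ij\mathbb{Q}$, where $i^2=\alpha\in\mathbb{Q}\setminus\{0\}$, $j^2=\beta\in\mathbb{Q}\setminus\{0\}$ with $ij=-ji$ and $\alpha>0$, $\alpha\ge\beta$. Write $f\in\mathrm{End}(X)$ as $f=a+bi+cj+d\,ij$ with $a,b,c,d\in\mathbb{Q}$. Then $\#\mathrm{Fix}(f^n)$ is periodic if $\left|a+\sqrt{b^2\alpha+c^2\beta-d^2\alpha\beta}\right|=1$, and it grows exponentially otherwise. (c) Suppose that $X$ has complex multiplication, and let $\sigma:\mathrm{End}(X)\hookrightarrow\mathbb{C}$ be an embedding (injective ring homomorphism). Then $\#\mathrm{Fix}(f^n)$ is periodic if $|\sigma(f)|=1$, and it grows exponentially otherwise.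
   Context: $\mathrm{End}(X)$ is the ring of holomorphic group endomorphisms of $X$ and $\mathrm{End}_{\mathbb{Q}}(X)=\mathrm{End}(X)\otimes_{\mathbb{Z}}\mathbb{Q}$; $\mathrm{End}(X)$ is regarded as a subring of $\mathrm{End}_{\mathbb{Q}}(X)$. $X$ has complex multiplication if $\mathrm{End}_{\mathbb{Q}}(X)$ is isomorphic to a CM field of degree 4, i.e., an imaginary quadratic extension of a real quadratic number field $\mathbb{Q}(\sqrt d)$, $d$ a positive square-free integer. $f^n=f\circ\cdots\circ f$ is the $n$-th iterate ($n\ge 1$). $\#\mathrm{Fix}(f)$ denotes the number of fixed points of $f$, with the convention $\#\mathrm{Fix}(f)=0$ if the set of fixed points is infinite. The square root in (b) is taken in $\mathbb{C}$ (the radicand is a rational number, possibly negative). Behaviours: (B1) A function $h$ of $n$ grows exponentially if there are real constants $A,B>1$ and an integer $N$ with $A^n\le h(n)\le B^n$ for all $n\ge N$. (B2) The function is a periodic function of $n$. (B3) The function equals $0$ if $n\equiv 0\pmod r$ and $h(n)$ otherwise, where $r\ge 2$ is an integer and $h$ is an exponentially growing function. *)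

(* Defs.v *)
From HB Require Import structures.
From mathcomp Require Import all_boot all_order all_algebra.
From mathcomp Require Import all_field finmap.
From mathcomp Require Import all_classical all_reals all_analysis.
From mathcomp Require Import complex.
From mathcomp Require Import ring zify.

Set Implicit Arguments.
Unset Strict Implicit.
Unset Printing Implicit Defensive.

Import Order.TTheory GRing.Theory Num.Theory.
Import numFieldNormedType.Exports.
Local Open Scope classical_set_scope.
Local Open Scope ring_scope.

(* E (x)_Z Q, constructed as the localization of E at the positive integers:  *)
(* the pair (f, n) stands for the fraction f (x) 1/(n+1), and (f, m), (g, n)  *)
(* are identified when (n+1)f - (m+1)g is a torsion element.                  *)
Section RationalTensor.
Variable E : pzRingType.
Local Open Scope quotient_scope.

Definition frac_equiv (x y : E * nat) : bool :=
  `[< exists k : nat, (x.1 *+ y.2.+1 - y.1 *+ x.2.+1) *+ k.+1 = 0 >].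

Lemma frac_equivP (x y : E * nat) :
  reflect (exists2 k : nat, (0 < k)%N &
             x.1 *+ (y.2.+1 * k) = y.1 *+ (x.2.+1 * k))
          (frac_equiv x y).
Proof.
apply: (iffP (asboolP _)).
  case=> k /eqP; rewrite mulrnBl subr_eq0 -!mulrnA => /eqP kE.
  by exists k.+1.
case=> -[//|k] _ kE; exists k.
by rewrite mulrnBl -!mulrnA kE subrr.
Qed.

Lemma mulrn_eqM (x y : E) m n k m' n' :
  x *+ m = y *+ n -> m' = (m * k)%N -> n' = (n * k)%N -> x *+ m' = y *+ n'.
Proof. by move=> xy -> ->; rewrite !mulrnA xy. Qed.

Lemma frac_equiv_is_equiv : equiv_class_of frac_equiv.
Proof.
split=> [x|x y|y x z].
- by apply/frac_equivP; exists 1%N.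
- by apply/frac_equivP/frac_equivP => -[k k0 xy]; exists k.
- move=> /frac_equivP[k k0 xy] /frac_equivP[l l0 yz]; apply/frac_equivP.
  exists (y.2.+1 * k * l)%N; first by rewrite !muln_gt0 k0 l0.
  rewrite (@mulrn_eqM _ _ _ _ (z.2.+1 * l) _ (z.2.+1 * l * (x.2.+1 * k)) xy);
    try lia.
  by apply: (mulrn_eqM (k := x.2.+1 * k) yz); lia.
Qed.

Canonical frac_equiv_equiv := EquivRelPack frac_equiv_is_equiv.
Canonical frac_equiv_encModRel := defaultEncModRel frac_equiv.

Definition ratTensor := {eq_quot frac_equiv}.
HB.instance Definition _ := EqQuotient.on ratTensor.
HB.instance Definition _ := Choice.on ratTensor.

Definition frac_den (m n : nat) : nat := (m.+1 * n.+1).-1.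

Lemma frac_denE m n : (frac_den m n).+1 = (m.+1 * n.+1)%N.
Proof. by rewrite /frac_den prednK. Qed.

Local Arguments frac_den : simpl never.

Definition frac_add (x y : E * nat) : E * nat :=
  (x.1 *+ y.2.+1 + y.1 *+ x.2.+1, frac_den x.2 y.2).
Definition frac_opp (x : E * nat) : E * nat := (- x.1, x.2).
Definition frac_mul (x y : E * nat) : E * nat := (x.1 * y.1, frac_den x.2 y.2).
Definition frac_scale (a : rat) (x : E * nat) : E * nat :=
  (x.1 *~ numq a, (`|denq a|%N * x.2.+1).-1).

Definition rt_zero : ratTensor := \pi_ratTensor (0, 0%N).
Definition rt_one : ratTensor := \pi_ratTensor (1, 0%N).
Definition rt_add (x y : ratTensor) :=
  \pi_ratTensor (frac_add (repr x) (repr y)).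
Definition rt_opp (x : ratTensor) :=
  \pi_ratTensor (frac_opp (repr x)).
Definition rt_mul (x y : ratTensor) :=
  \pi_ratTensor (frac_mul (repr x) (repr y)).
Definition rt_scale (a : rat) (x : ratTensor) :=
  \pi_ratTensor (frac_scale a (repr x)).

Lemma rt_eq (x y : E * nat) k : (0 < k)%N ->
  x.1 *+ (y.2.+1 * k) = y.1 *+ (x.2.+1 * k) ->
  \pi_ratTensor x = \pi_ratTensor y.
Proof. by move=> k0 xy; apply/eqmodP/frac_equivP; exists k. Qed.

Lemma rt_eq1 (x y : E * nat) :
  x.1 *+ y.2.+1 = y.1 *+ x.2.+1 -> \pi_ratTensor x = \pi_ratTensor y.
Proof. by move=> xy; apply: (@rt_eq _ _ 1); rewrite ?muln1. Qed.

Lemma rt_repr (x : E * nat) : exists2 k : nat, (0 < k)%N &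
  (repr (\pi_ratTensor x)).1 *+ (x.2.+1 * k) =
  x.1 *+ ((repr (\pi_ratTensor x)).2.+1 * k).
Proof. by apply/frac_equivP/eqmodP; rewrite reprK. Qed.

Lemma rt_pi_add x y :
  rt_add (\pi_ratTensor x) (\pi_ratTensor y) = \pi_ratTensor (frac_add x y).
Proof.
rewrite /rt_add /frac_add; have [k k0] := rt_repr x; have [l l0] := rt_repr y.
move: (repr _) (repr _) => x' y' yy xx.
apply: (@rt_eq _ _ (k * l)); first by rewrite muln_gt0 k0.
rewrite /= !frac_denE !mulrnDl -!mulrnA; congr (_ + _).
  by apply: (mulrn_eqM (k := y'.2.+1 * y.2.+1 * l) xx); lia.
by apply: (mulrn_eqM (k := x'.2.+1 * x.2.+1 * k) yy); lia.
Qed.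

Lemma rt_pi_opp x : rt_opp (\pi_ratTensor x) = \pi_ratTensor (frac_opp x).
Proof.
rewrite /rt_opp /frac_opp; have [k k0] := rt_repr x.
move: (repr _) => x' xx.
by apply: (rt_eq k0); rewrite /= !mulNrn xx.
Qed.

Lemma rt_pi_mul x y :
  rt_mul (\pi_ratTensor x) (\pi_ratTensor y) = \pi_ratTensor (frac_mul x y).
Proof.
rewrite /rt_mul /frac_mul; have [k k0] := rt_repr x; have [l l0] := rt_repr y.
move: (repr _) (repr _) => x' y' yy xx.
apply: (@rt_eq _ _ (k * l)); first by rewrite muln_gt0 k0.
rewrite /= !frac_denE.
rewrite [in LHS](_ : (_ * _ = x.2.+1 * k * (y.2.+1 * l))%N); last by lia.
rewrite [in RHS](_ : (_ * (k * l) = x'.2.+1 * k * (y'.2.+1 * l))%N);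
  last by lia.
have e (u v : E) m n : u * v *+ (m * n) = (u *+ m) * (v *+ n).
  by rewrite mulrnAl mulrnAr -mulrnA mulnC.
by rewrite !e xx yy.
Qed.

Lemma rt_pi_scale a x :
  rt_scale a (\pi_ratTensor x) = \pi_ratTensor (frac_scale a x).
Proof.
rewrite /rt_scale /frac_scale; have [k k0] := rt_repr x.
move: (repr _) => x' xx.
have d0 : (0 < `|denq a|)%N by rewrite absz_gt0 denq_eq0.
apply: (rt_eq k0); rewrite /= !prednK ?muln_gt0 ?d0 // !pmulrn -!mulrzA.
rewrite ![numq a * _]mulrC !mulrzA -!pmulrn; congr (_ *~ _).
by apply: (mulrn_eqM (k := `|denq a|) xx); lia.
Qed.

Lemma rt_ind (P : ratTensor -> Prop) :
  (forall x, P (\pi_ratTensor x)) -> forall x, P x.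
Proof. by move=> p x; rewrite -[x]reprK; apply: p. Qed.

Lemma rt_addA : associative rt_add.
Proof.
elim/rt_ind=> x; elim/rt_ind=> y; elim/rt_ind=> z.
rewrite !rt_pi_add; apply: rt_eq1.
rewrite /= !frac_denE !mulrnDl -!mulrnA -!addrA.
by congr (_ *+ _ + (_ *+ _ + _ *+ _)); lia.
Qed.

Lemma rt_addC : commutative rt_add.
Proof.
elim/rt_ind=> x; elim/rt_ind=> y; rewrite !rt_pi_add; apply: rt_eq1.
by rewrite /= !frac_denE addrC mulnC.
Qed.

Lemma rt_add0 : left_id rt_zero rt_add.
Proof.
elim/rt_ind=> x; rewrite rt_pi_add; apply: rt_eq1.
by rewrite /= frac_denE mul0rn add0r mulr1n mul1n.
Qed.

Lemma rt_addN : left_inverse rt_zero rt_opp rt_add.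
Proof.
elim/rt_ind=> x; rewrite rt_pi_opp rt_pi_add; apply: rt_eq1.
by rewrite /= mulNrn addNr !mul0rn.
Qed.

HB.instance Definition _ :=
  GRing.isZmodule.Build ratTensor rt_addA rt_addC rt_add0 rt_addN.

Lemma rt_mulA : associative rt_mul.
Proof.
elim/rt_ind=> x; elim/rt_ind=> y; elim/rt_ind=> z.
rewrite !rt_pi_mul; apply: rt_eq1.
by rewrite /= !frac_denE mulrA mulnA.
Qed.

Lemma rt_mul1 : left_id rt_one rt_mul.
Proof.
elim/rt_ind=> x; rewrite rt_pi_mul; apply: rt_eq1.
by rewrite /= frac_denE mul1r mul1n.
Qed.

Lemma rt_mulr1 : right_id rt_one rt_mul.
Proof.
elim/rt_ind=> x; rewrite rt_pi_mul; apply: rt_eq1.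
by rewrite /= frac_denE mulr1 muln1.
Qed.

Lemma rt_mulDl : left_distributive rt_mul rt_add.
Proof.
elim/rt_ind=> x; elim/rt_ind=> y; elim/rt_ind=> z.
rewrite [in LHS]rt_pi_add !rt_pi_mul rt_pi_add.
apply: rt_eq1; rewrite /= !frac_denE.
rewrite !mulrDl !mulrnDl -!mulrnA !mulrnAl -!mulrnA.
by congr (_ *+ _ + _ *+ _); lia.
Qed.

Lemma rt_mulDr : right_distributive rt_mul rt_add.
Proof.
elim/rt_ind=> x; elim/rt_ind=> y; elim/rt_ind=> z.
rewrite [in LHS]rt_pi_add !rt_pi_mul rt_pi_add.
apply: rt_eq1; rewrite /= !frac_denE.
rewrite !mulrDr !mulrnDl -!mulrnA !mulrnAr -!mulrnA.
by congr (_ *+ _ + _ *+ _); lia.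
Qed.

HB.instance Definition _ := GRing.Zmodule_isPzRing.Build ratTensor
  rt_mulA rt_mul1 rt_mulr1 rt_mulDl rt_mulDr.

Lemma rt_frac (f : E) (m n : int) (d e : nat) : (0 < d)%N -> (0 < e)%N ->
  m * e = n * d ->
  \pi_ratTensor (f *~ m, d.-1) = \pi_ratTensor (f *~ n, e.-1).
Proof.
move=> d0 e0 mn; apply: rt_eq1.
by rewrite /= !prednK // !pmulrn -!mulrzA -mn.
Qed.

Lemma rt_scaleA a b x :
  rt_scale a (rt_scale b x) = rt_scale (a * b) x.
Proof.
elim/rt_ind: x => x; rewrite !rt_pi_scale /frac_scale /= -mulrzA.
have da : (0 < `|denq a|)%N by rewrite absz_gt0 denq_eq0.
have db : (0 < `|denq b|)%N by rewrite absz_gt0 denq_eq0.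
have dab : (0 < `|denq (a * b)|)%N by rewrite absz_gt0 denq_eq0.
rewrite prednK ?muln_gt0 ?db //; apply: rt_frac;
  rewrite ?muln_gt0 ?da ?db ?dab //.
rewrite !PoszM !absz_denq.
suff e : numq b * numq a * denq (a * b) = numq (a * b) * (denq a * denq b).
  by rewrite mulrA e !mulrA.
apply: (@intr_inj rat); rewrite !rmorphM /=.
have e1 c : (numq c)%:~R = c * (denq c)%:~R :> rat.
  by rewrite -{2}[c]divq_num_den divfK // intr_eq0 denq_eq0.
by rewrite !e1; ring.
Qed.

Lemma rt_scale1 : left_id 1 rt_scale.
Proof.
elim/rt_ind=> -[f m]; rewrite rt_pi_scale; congr (\pi_ratTensor _).
by rewrite /frac_scale (denq_int 1) (numq_int 1) mul1n mulr1z.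
Qed.

Lemma rt_scaleDr : right_distributive rt_scale rt_add.
Proof.
move=> a; elim/rt_ind=> x; elim/rt_ind=> y; rewrite !(rt_pi_scale, rt_pi_add).
have da : (0 < `|denq a|)%N by rewrite absz_gt0 denq_eq0.
apply: rt_eq1; rewrite /= !prednK ?muln_gt0 ?da //.
rewrite mulrzDl !mulrnDl !pmulrn -!mulrzA.
by congr (_ *~ _ + _ *~ _); rewrite !PoszM; ring.
Qed.

Lemma rt_scaleDl x : {morph rt_scale^~ x : a b / a + b >-> rt_add a b}.
Proof.
move=> a b; elim/rt_ind: x => x; rewrite !(rt_pi_scale, rt_pi_add).
have da : (0 < `|denq a|)%N by rewrite absz_gt0 denq_eq0.
have db : (0 < `|denq b|)%N by rewrite absz_gt0 denq_eq0.
have dab : (0 < `|denq (a + b)|)%N by rewrite absz_gt0 denq_eq0.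
rewrite /frac_add /frac_scale /= !prednK ?muln_gt0 ?da ?db ?dab //.
rewrite !pmulrn -!mulrzA -mulrzDr.
apply: rt_frac; rewrite ?muln_gt0 ?da ?db ?dab //.
rewrite !prednK ?muln_gt0 ?da ?db // !PoszM !absz_denq.
apply: (@intr_inj rat); rewrite !(rmorphM, rmorphD) /=.
have e1 c : (numq c)%:~R = c * (denq c)%:~R :> rat.
  by rewrite -{2}[c]divq_num_den divfK // intr_eq0 denq_eq0.
by rewrite !e1; ring.
Qed.

HB.instance Definition _ := GRing.Zmodule_isLmodule.Build rat ratTensor
  rt_scaleA rt_scale1 rt_scaleDr rt_scaleDl.

Lemma rt_scaleAl a (x y : ratTensor) : a *: (x * y) = a *: x * y.
Proof.
elim/rt_ind: x => x; elim/rt_ind: y => y.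
have da : (0 < `|denq a|)%N by rewrite absz_gt0 denq_eq0.
change (rt_scale a (rt_mul (\pi x) (\pi y)) =
  rt_mul (rt_scale a (\pi x)) (\pi y)).
rewrite rt_pi_mul !rt_pi_scale rt_pi_mul; apply: rt_eq1.
rewrite /= !frac_denE !prednK ?muln_gt0 ?da //.
by rewrite mulrzAl mulnA.
Qed.

Lemma rt_scaleAr a (x y : ratTensor) : a *: (x * y) = x * (a *: y).
Proof.
elim/rt_ind: x => x; elim/rt_ind: y => y.
have da : (0 < `|denq a|)%N by rewrite absz_gt0 denq_eq0.
change (rt_scale a (rt_mul (\pi x) (\pi y)) =
  rt_mul (\pi x) (rt_scale a (\pi y))).
rewrite rt_pi_mul !rt_pi_scale rt_pi_mul; apply: rt_eq1.
rewrite /= !frac_denE !prednK ?muln_gt0 ?da //.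
by rewrite mulrzAr mulnCA.
Qed.

Definition toRatTensor (f : E) : ratTensor := \pi_ratTensor (f, 0%N).

End RationalTensor.

Definition squarefree (d : nat) : Prop :=
  forall k : nat, (k ^ 2 %| d)%N -> k = 1%N.

Lemma near_comp (S T : topologicalType) (g : S -> T) (z : S) (P : T -> Prop) :
  {for z, continuous g} ->
  (\forall y \near g z, P y) -> \forall w \near z, P (g w).
Proof. by move=> gc /gc. Qed.

Lemma near_differentiable_comp (K : numFieldType) (U V W : normedModType K)
    (f : V -> W) (g : U -> V) (z : U) :
  (\forall w \near z, differentiable g w) ->
  (\forall w \near g z, differentiable f w) ->
  \forall w \near z, differentiable (f \o g) w.
Proof.
move=> gd fd; have gc : {for z, continuous g}.
  by apply: differentiable_continuous; exact: nbhs_singleton gd.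
by apply: filterS2 gd (near_comp gc fd) => w ? ?; exact: differentiable_comp.
Qed.

Section ComplexTori.
Variable R : realType.
Local Notation C := (R[i] : numClosedFieldType).
Local Notation V := 'rV[C]_2.
Local Open Scope quotient_scope.
Local Open Scope complex_scope.

(* A lattice in C^2, given by an R-basis (p_i) of C^2; Lambda = (+)_i Z p_i.  *)
Record lattice := Lattice {
  period : 'I_4 -> V;
  period_free : forall c : 'I_4 -> R,
    \sum_i (c i)%:C *: period i = 0 -> forall i, c i = 0 }.

Variable L : lattice.

Definition in_lattice : pred V :=
  fun v => `[< exists m : 'I_4 -> int, v = \sum_i period L i *~ m i >].

Lemma in_lattice_zmod : zmod_closed in_lattice.
Proof.
split=> [|u v /asboolP[m ->] /asboolP[n ->]]; apply/asboolP.
  by exists (fun=> 0); rewrite big1.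
exists (fun i => m i - n i); rewrite -sumrB.
by apply: eq_bigr => i _; rewrite mulrzBr.
Qed.

HB.instance Definition _ :=
  GRing.isZmodClosed.Build V in_lattice in_lattice_zmod.

Definition torus := Quotient.quot (GRing.ZmodClosed.clone _ in_lattice _).
HB.instance Definition _ := GRing.Zmodule.on torus.
HB.instance Definition _ := EqQuotient.on torus.
Definition toTorus (v : V) : torus := \pi_torus v.

Lemma toTorus_is_additive : zmod_morphism toTorus.
Proof. by move=> u v; rewrite /toTorus raddfB. Qed.

HB.instance Definition _ :=
  GRing.isZmodMorphism.Build V torus toTorus toTorus_is_additive.

(* f is holomorphic iff it lifts locally, along the projection from V, to     *)
(* complex differentiable maps.                                               *)
Definition holomorphic (f : torus -> torus) : Prop :=
  forall z : V, exists F : V -> V,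
    (\forall w \near z, differentiable F w) /\
    (\forall w \near z, toTorus (F w) = f (toTorus w)).

(* The elements of End(X), with the composition product below.                *)
Definition is_endo : pred (torus -> torus) :=
  fun f => `[< {morph f : x y / x + y} /\ holomorphic f >].

Lemma is_endo_zmod : zmod_closed is_endo.
Proof.
split=> [|f g /asboolP[fD fh] /asboolP[gD gh]]; apply/asboolP; split.
- by move=> x y; rewrite addr0.
- move=> z; exists (fun=> 0); split; apply: filterE => w.
    exact: differentiable_cst.
  by exact: raddf0.
- by move=> x y; rewrite /= !fctE fD gD opprD addrACA.
- move=> z; have [F [Fd Ff]] := fh z; have [G [Gd Gg]] := gh z.
  exists (fun w => F w - G w); split.
    by apply: filterS2 Fd Gd => w Fw Gw; exact: differentiableB.
  apply: filterS2 Ff Gg => w Fw Gw.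
  by rewrite toTorus_is_additive Fw Gw.
Qed.

Lemma is_endo_id : is_endo id.
Proof.
apply/asboolP; split=> // z; exists id; split; apply: filterE => // w.
Qed.

Lemma is_endo_comp f g : is_endo f -> is_endo g -> is_endo (f \o g).
Proof.
move=> /asboolP[fD fh] /asboolP[gD gh]; apply/asboolP; split.
  by move=> x y /=; rewrite gD fD.
move=> z; have [G [Gd Gg]] := gh z; have [F [Fd Ff]] := fh (G z).
have Gc : {for z, continuous G}.
  by apply: differentiable_continuous; exact: nbhs_singleton Gd.
exists (F \o G); split; first exact: near_differentiable_comp.
have Ff' := near_comp Gc Ff.
by apply: filterS2 Gg Ff' => w /= <- <-.
Qed.

HB.instance Definition _ :=
  GRing.isZmodClosed.Build (torus -> torus) is_endo is_endo_zmod.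

Record endo := Endo { endo_fun :> torus -> torus; _ : is_endo endo_fun }.
HB.instance Definition _ := [isSub for endo_fun].
HB.instance Definition _ := [Choice of endo by <:].
HB.instance Definition _ := [SubChoice_isSubZmodule of endo by <:].

Lemma endoP (f : endo) : is_endo f. Proof. exact: valP. Qed.

Lemma endoD (f : endo) : {morph f : x y / x + y}.
Proof. by have /asboolP[] := endoP f. Qed.

Definition endo_one : endo := Endo is_endo_id.
Definition endo_mul (f g : endo) : endo :=
  Endo (is_endo_comp (endoP f) (endoP g)).

Lemma endo_mulA : associative endo_mul.
Proof. by move=> f g h; apply: val_inj. Qed.
Lemma endo_mul1 : left_id endo_one endo_mul.
Proof. by move=> f; apply: val_inj. Qed.
Lemma endo_mulr1 : right_id endo_one endo_mul.
Proof. by move=> f; apply: val_inj. Qed.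
Lemma endo_mulDl : left_distributive endo_mul +%R.
Proof. by move=> f g h; apply: val_inj. Qed.
Lemma endo_mulDr : right_distributive endo_mul +%R.
Proof.
by move=> f g h; apply: val_inj; apply/funext => x /=; rewrite endoD.
Qed.

HB.instance Definition _ := GRing.Zmodule_isPzRing.Build endo
  endo_mulA endo_mul1 endo_mulr1 endo_mulDl endo_mulDr.

Definition endoQ := ratTensor endo.
HB.instance Definition _ := GRing.PzRing.on endoQ.
HB.instance Definition _ := GRing.Lmodule.on endoQ.

Lemma endo_mulrnE (f : endo) (n : nat) x : (f *+ n) x = f x *+ n.
Proof.
elim: n => [|n IHn]; first by rewrite !mulr0n.
by rewrite !mulrS -IHn.
Qed.

Lemma toTorus_eq0 (v : V) : toTorus v = 0 -> in_lattice v.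
Proof.
rewrite -(raddf0 toTorus).
by move/eqP; rewrite -Quotient.idealrBE subr0.
Qed.

Lemma endo_one_mulrn_neq0 (k : nat) : (0 < k)%N -> (1 : endo) *+ k != 0.
Proof.
move=> k0; apply/eqP => k1.
pose v : V := ((2 * k)%:R^-1 : R)%:C *: period L ord0.
have /toTorus_eq0/asboolP[m mE] : toTorus (v *+ k) = 0.
  rewrite (_ : toTorus (v *+ k) = toTorus v *+ k); last exact: raddfMn.
  by rewrite -[toTorus v]/((1 : endo) _) -endo_mulrnE k1.
have vk : v *+ k = (2^-1 : R)%:C *: period L ord0.
  rewrite /v scalerMnl; congr (_ *: _); rewrite -rmorphMn; congr (_%:C).
  rewrite -[RHS]mulr1 -[_ *+ k]mulr_natr natrM invfM -mulrA mulVf //.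
  by rewrite pnatr_eq0 -lt0n.
have := @period_free L (fun i => (i == ord0)%:R / 2 - (m i)%:~R).
have -> : \sum_i ((i == ord0)%:R / 2 - (m i)%:~R : R)%:C *: period L i = 0.
  rewrite (eq_bigr (fun i => ((i == ord0)%:R / 2 : R)%:C *: period L i
      - period L i *~ m i)); last first.
    by move=> i _; rewrite rmorphB /= scalerBl rmorph_int scaler_int.
  rewrite sumrB -mE vk (bigD1 ord0) // eqxx mul1r big1 => [|i].
    by rewrite [X in X - _]addr0 subrr.
  by move=> /negPf ->; rewrite mul0r scale0r.
move=> /(_ erefl ord0); rewrite eqxx mul1r => /eqP; rewrite subr_eq0 => /eqP h.
have : ((m ord0 * 2)%:~R : R) = 1%:~R.
  by rewrite intrM -h mulVf // pnatr_eq0.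
by move/intr_inj; lia.
Qed.

Lemma endo_one_neq0 : (1 : endo) != 0.
Proof. by rewrite -[1]mulr1n; apply: endo_one_mulrn_neq0. Qed.

HB.instance Definition _ := GRing.PzSemiRing_isNonZero.Build endo endo_one_neq0.

Lemma endoQ_one_neq0 : (1 : endoQ) != 0.
Proof.
apply/eqP => /eqmodP/frac_equivP[k k0] /=.
by rewrite mul0rn mul1n; apply/eqP/endo_one_mulrn_neq0.
Qed.

HB.instance Definition _ :=
  GRing.PzSemiRing_isNonZero.Build endoQ endoQ_one_neq0.
HB.instance Definition _ :=
  GRing.Lmodule_isLalgebra.Build rat endoQ (@rt_scaleAl endo).
HB.instance Definition _ :=
  GRing.Lalgebra_isAlgebra.Build rat endoQ (@rt_scaleAr endo).

Definition endo_toQ (f : endo) : endoQ := toRatTensor f.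

(* A complex torus is an abelian variety iff it carries a positive definite   *)
(* Hermitian form whose imaginary part is integral on the lattice.            *)
Definition abelian_surface : Prop :=
  exists H : {dot V for Num.conj}, forall u v : V,
    in_lattice u -> in_lattice v -> exists m : int, complex.Im (H u v) = m%:~R.

(* The complex subtori of V / Lambda are the images of the complex subspaces  *)
(* W in which W :&: Lambda is a lattice; since W :&: Lambda is discrete, this *)
(* means that it spans W over the reals.                                      *)
Definition is_subtorus (W : {vspace V}) : Prop :=
  forall w, w \in W -> exists (n : nat) (c : 'I_n -> R) (l : 'I_n -> V),
    (forall k, l k \in W /\ in_lattice (l k)) /\ w = \sum_k (c k)%:C *: l k.

Definition simple_surface : Prop :=
  forall W : {vspace V}, is_subtorus W -> W = 0%VS \/ W = fullv.

(* fset_set is empty on infinite sets, so this is 0 if there are infinitely   *)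
(* many fixed points.                                                         *)
Definition nb_fix (f : torus -> torus) : nat :=
  #|` fset_set [set x | f x = x] |%fset.

Definition fix_fun (f : endo) (n : nat) : R := (nb_fix (iter n f))%:R.

Definition real_multiplication (d : nat) : Prop :=
  exists phi : {rmorphism endoQ -> R}, injective phi /\
    range phi = [set x | exists a b : rat, x = ratr a + ratr b * Num.sqrt d%:R].

Definition quat_comb (i j : endoQ) (a b c d : rat) : endoQ :=
  a *: 1 + b *: i + c *: j + d *: (i * j).

Definition quaternion_multiplication (alpha beta : rat) (i j : endoQ) : Prop :=
  [/\ alpha != 0 /\ beta != 0,
      [/\ i ^+ 2 = alpha *: 1, j ^+ 2 = beta *: 1 & i * j = - (j * i)],
      (forall x, exists a b c d, x = quat_comb i j a b c d) &
      (forall a b c d, quat_comb i j a b c d = 0 ->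
         [/\ a = 0, b = 0, c = 0 & d = 0])].

(* K is a quadratic extension of Q(s), s = sqrt d, with no real embedding.    *)
(* As d > 1 is squarefree, Q(s) is a real quadratic field.                    *)
Definition quartic_CM_field (K : fieldExtType rat) : Prop :=
  exists (d : nat) (s : K),
    [/\ (1 < d)%N /\ squarefree d, s ^+ 2 = d%:R,
        \dim_(<<1%VS; s>>%VS) {:K} = 2 &
        forall tau : {rmorphism K -> C}, exists x, tau x \isn't Num.real].

Definition complex_multiplication : Prop :=
  exists K : fieldExtType rat, quartic_CM_field K /\
    exists phi : {rmorphism endoQ -> K}, bijective phi.

End ComplexTori.

Section Behaviours.
Variable R : realType.
Implicit Types h : nat -> R.

Definition exponential_behaviour h : Prop :=
  exists (A B : R) (N : nat), [/\ 1 < A, 1 < B &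
    forall n, (N <= n)%N -> A ^+ n <= h n <= B ^+ n].

(* The functions of interest are defined on n >= 1, so that n = 0 is left out *)
(* of the next two definitions.                                               *)
Definition periodic_behaviour h : Prop :=
  exists p : nat, (0 < p)%N /\ forall n, (0 < n)%N -> h (n + p)%N = h n.

Definition mixed_behaviour h : Prop :=
  exists (r : nat) (g : nat -> R), [/\ (2 <= r)%N, exponential_behaviour g &
    forall n, (0 < n)%N -> h n = if (r %| n)%N then 0 else g n].

End Behaviours.

(* Main.v *)
Require Import Defs.
From HB Require Import structures.
From mathcomp Require Import all_boot all_order all_algebra.
From mathcomp Require Import all_field finmap.
From mathcomp Require Import all_classical all_reals all_analysis.
From mathcomp Require Import complex.
From mathcomp Require Import ring lra zify.

Set Implicit Arguments.
Unset Strict Implicit.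
Unset Printing Implicit Defensive.

Import Order.TTheory GRing.Theory Num.Theory.
Import numFieldNormedType.Exports.
Local Open Scope classical_set_scope.
Local Open Scope ring_scope.

(** Let [A] be the 2 x 2 complex matrix through which [f] acts on the universal
    cover, and [M] the 4 x 4 integer matrix through which it acts on the
    lattice; [M] is conjugate over the complex numbers to the direct sum of [A]
    and its complex conjugate. The fixed points of [f ^ n] form the kernel of
    [f ^ n - 1], a finite group when [det (M ^ n - 1) <> 0], and then
    [#Fix (f ^ n)] and [|det (M ^ n - 1)|] bound each other up to a fourth
    power ([nb_fix_le], [det_le_nb_fix]); as
    [det (M ^ n - 1) = prod_z |z ^ n - 1| ^ 2] over the eigenvalues [z] of [A],
    the growth of [#Fix (f ^ n)] is read off from these eigenvalues.

    Simplicity enters through one statement ([horner_mx0_of_root]): if a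
    rational polynomial [p] vanishes at one eigenvalue of [A], then [p (A) = 0].
    Indeed the kernel of [p (A)] is the tangent space of a nonzero subtorus.
    Consequently the eigenvalues of [A] cannot be told apart over the rationals.

    - If one eigenvalue [w] has absolute value 1, the reversed characteristic
      polynomial of [M] vanishes at [w], since [w^-1] is the conjugate of [w],
      hence at every eigenvalue, and this forces all of them onto the unit
      circle ([unit_circle_spectrum]). By Kronecker's argument they are roots
      of unity; [X ^ k - 1] vanishes at one of them, so [f ^ k = 1] and the
      fixed-point function is periodic.
    - If no eigenvalue lies on the unit circle, then
      [|z ^ n - 1| >= | |z| ^ n - 1 |] is bounded below by a constant times
      [max (1, |z|) ^ n]. The product of the eigenvalues has absolute value at
      least 1 because [det M] is a nonzero integer, so some [|z|] exceeds 1 and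
      the growth is exponential.

    In particular the borderline case of an eigenvalue on the unit circle that
    is not a root of unity never occurs. This dichotomy ([endo_dichotomy])
    excludes the mixed behaviour, and in each of the three cases it remains to
    match the stated number with an eigenvalue. With real multiplication, an
    element of finite order is a real root of unity. With quaternion
    multiplication, [f] satisfies [(f - a) ^ 2 = delta] with rational [delta],
    so an eigenvalue is [a + s] or [a - s] with [s ^ 2 = delta]; these two have
    the same absolute value if [delta < 0], and otherwise they are real, so
    that one of absolute value 1 is rational and makes [f] a scalar. With
    complex multiplication, [sigma f] is a root of the characteristic
    polynomial of [M]. *)

(** * Spectra of polynomials in a matrix *)

Section SpectralMapping.
Variables (F : closedFieldType) (n : nat) (A : 'M[F]_n.+1) (rs : seq F).
Hypothesis chA : char_poly A = \prod_(z <- rs) ('X - z%:P).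

Lemma size_spectrum : size rs = n.+1.
Proof.
by apply/succn_inj; rewrite -(size_char_poly A) chA size_prod_XsubC.
Qed.

Lemma horner_char_poly (B : 'M[F]_n.+1) t : (char_poly B).[t] = \det (t%:M - B).
Proof.
rewrite /char_poly -[_.[t]]/(horner_eval t _) -det_map_mx; congr (\det _).
apply/matrixP => i j; rewrite !mxE /= /horner_eval !hornerE.
by case: eqP => _; rewrite ?mulr1n ?mulr0n ?hornerE.
Qed.

(** Split [q] into linear factors: each [det (A - t)] is a value of the
    characteristic polynomial, and the double product can be taken in either
    order. *)
Lemma det_horner_mx (q : {poly F}) :
  \det (horner_mx A q) = \prod_(z <- rs) q.[z].
Proof.
have [r ->] := closed_field_poly_normal q; set c := lead_coef q.
have lin t : \det (horner_mx A ('X - t%:P)) = \prod_(z <- rs) ('X - t%:P).[z].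
  rewrite rmorphB /= horner_mx_X horner_mx_C -opprB -scaleN1r detZ.
  rewrite -horner_char_poly chA horner_prod -size_spectrum.
  elim: (rs) => [|z s IHs]; first by rewrite !big_nil expr0 mul1r.
  rewrite !big_cons -IHs /= exprS !hornerE.
  have signM (e u p : F) : -1 * e * u * p = - u * e * p by ring.
  by rewrite -[z - t]opprB; exact: signM.
rewrite linearZ detZ rmorph_prod -[c ^+ _](_ : c ^+ size rs = _); last first.
  by rewrite size_spectrum.
have -> : \det (\prod_(t <- r) (horner_mx A) ('X - t%:P)) =
    \prod_(t <- r) \prod_(z <- rs) ('X - t%:P).[z].
  elim: r => [|t r IHr]; first by rewrite !big_nil det1.
  by rewrite !big_cons -IHr -lin -det_mulmx.
under [RHS]eq_bigr => z _ do rewrite hornerZ horner_prod.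
rewrite big_split /= exchange_big /=; congr (_ * _).
by rewrite big_const_seq count_predT iter_mulr_1.
Qed.

End SpectralMapping.

Section Kronecker.
Variable C : numClosedFieldType.

(** In characteristic 0 the natural numbers are infinitely many points. *)
Lemma poly_natP (p q : {poly C}) : (forall k : nat, p.[k%:R] = q.[k%:R]) -> p = q.
Proof.
move=> pq; apply/eqP; rewrite -subr_eq0; apply/eqP.
apply: (@roots_geq_poly_eq0 _ _ [seq k%:R | k <- iota 0 (size (p - q))]).
- by apply/allP => _ /mapP[k _ ->]; rewrite rootE !hornerE pq subrr.
- by rewrite map_inj_uniq ?iota_uniq // => k l /eqP; rewrite eqr_nat => /eqP.
- by rewrite size_map size_iota.
Qed.

(** At a point [k] both sides are [det (k - A ^ m)], the determinant of a
    polynomial in [A]. *)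
Lemma char_poly_expr n (A : 'M[C]_n.+1) (rs : seq C) m :
  char_poly A = \prod_(z <- rs) ('X - z%:P) ->
  char_poly (A ^+ m) = \prod_(z <- rs) ('X - (z ^+ m)%:P).
Proof.
move=> chA; apply: poly_natP => k.
rewrite horner_char_poly -[A ^+ m](_ : horner_mx A 'X^m = _); last first.
  by rewrite rmorphXn /= horner_mx_X.
rewrite -(horner_mx_C A) -raddfB (det_horner_mx chA) horner_prod.
by apply: eq_bigr => z _; rewrite !hornerE.
Qed.

(** Multiplication by ['X - z] with [z] in the unit disc at most doubles the
    largest coefficient. *)
Lemma norm_coef_prod_XsubC (rs : seq C) i : all (fun z => `|z| <= 1) rs ->
  `|(\prod_(z <- rs) ('X - z%:P))`_i| <= 2 ^+ size rs.
Proof.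
elim: rs i => [|z s IHs] i /=.
  by move=> _; rewrite big_nil coef1 expr0; case: eqP; rewrite ?normr1 ?normr0.
case/andP=> z1 s1; rewrite big_cons mulrBl coefB coefXM coefCM.
apply: le_trans (ler_normB _ _) _; rewrite exprS mulr_natl mulr2n lerD //.
  by case: eqP => _; rewrite ?normr0 ?exprn_ge0 ?ler0n ?IHs.
by rewrite normrM -[leRHS]mul1r ler_pM ?normr_ge0 ?IHs.
Qed.

End Kronecker.

(** * Integer and rational matrices *)

Section IntegerMatrices.
Variable C : numClosedFieldType.

Lemma finite_root_set (p : {poly C}) : p != 0 -> finite_set [set x | root p x].
Proof.
move=> p0; have [r pE] := closed_field_poly_normal p.
apply: (@sub_finite_set _ _ [set` r]); last exact: finite_seq.
by move=> x /=; rewrite pE rootZ ?lead_coef_eq0 // root_prod_XsubC.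
Qed.

(** Kronecker's argument: the characteristic polynomials of the powers of [M]
    have integer coefficients of bounded size, so there are finitely many of
    them, and all powers of [z] lie among their finitely many roots. *)
Lemma int_spectrum_expr_collide n (M : 'M[int]_n.+1) (rs : seq C) z :
  char_poly (map_mx intr M) = \prod_(w <- rs) ('X - w%:P) ->
  all (fun w => `|w| <= 1) rs -> z \in rs ->
  exists k l, (k < l)%N /\ z ^+ k = z ^+ l.
Proof.
move=> chM rs1 zrs; pose B := (2 ^ n.+1)%N.
(* [P] lists the integer polynomials of size at most [n + 2] with coefficients
   in [-B, B]; the shift by [B] makes the coefficients ordinals. *)
pose P (r : {ffun 'I_n.+2 -> 'I_(2 * B).+1}) : {poly C} :=
  map_poly intr (\poly_(i < n.+2) ((r (inord i))%:Z - B%:Z)).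
have finT : finite_set (\bigcup_(r in [set r | P r != 0]) [set x | root (P r) x]).
  by apply: bigcup_finite; [exact: finite_finset | move=> r /= /finite_root_set].
have inT m : (\bigcup_(r in [set r | P r != 0]) [set x | root (P r) x]) (z ^+ m).
  have chm := char_poly_expr m chM; pose q := char_poly (M ^+ m).
  have qE : map_poly intr q = \prod_(w <- rs) ('X - (w ^+ m)%:P) :> {poly C}.
    by rewrite -chm map_char_poly rmorphXn.
  have cf i : `|q`_i| <= B%:Z.
    rewrite -(ler_int C) intr_norm -coef_map qE -(big_map (fun w => w ^+ m)
      xpredT (fun w => 'X - w%:P)) /B -pmulrn natrX.
    rewrite -(size_spectrum chM) -(size_map (fun w => w ^+ m) rs).
    apply: norm_coef_prod_XsubC; rewrite all_map; apply/allP => w wrs /=.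
    by rewrite normrX exprn_ile1 ?normr_ge0 ?(allP rs1).
  pose r : {ffun 'I_n.+2 -> 'I_(2 * B).+1} :=
    [ffun i : 'I_n.+2 => inord (absz (q`_i + B%:Z))].
  have Pr : P r = map_poly intr q.
    congr (map_poly _ _); apply/polyP => i; rewrite coef_poly.
    case: ltnP => [iN|Ni]; last by rewrite nth_default // size_char_poly.
    rewrite ffunE (inordK iN); have := cf i; move: (q`_i) => c cB.
    by rewrite inordK; lia.
  exists r; rewrite /= Pr qE; first exact/monic_neq0/monic_prod_XsubC.
  apply/rootP; rewrite horner_prod; apply/eqP; rewrite prodf_seq_eq0.
  by apply/hasP; exists z; rewrite /= ?hornerE ?subrr.
apply: contrapT => nex.
have finN : finite_set ((fun m : nat => z ^+ m) @^-1`
   (\bigcup_(r in [set r | P r != 0]) [set x | root (P r) x])).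
  apply: finite_preimage finT => k l _ _ /= kl; apply: contrapT => /eqP.
  by rewrite neq_ltn => /orP[] h; apply: nex; [exists k, l | exists l, k].
apply: infinite_nat; apply: sub_finite_set finN => m _; exact: inT.
Qed.

Lemma horner_rev_poly (p : {poly rat}) n (z : C) : (size p <= n.+1)%N -> z != 0 ->
  (map_poly ratr (\poly_(i < n.+1) p`_(n - i))).[z] =
  z ^+ n * (map_poly ratr p).[z^-1].
Proof.
move=> sp z0; rewrite (@horner_coef_wide _ n.+1); last first.
  by rewrite size_map_poly size_poly.
rewrite (@horner_coef_wide _ n.+1 (map_poly _ p)) ?size_map_poly //.
rewrite mulr_sumr (reindex_inj rev_ord_inj) /=; apply: eq_bigr => i _.
have ile : (i <= n)%N by rewrite -ltnS ltn_ord.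
rewrite !coef_map coef_poly subSS ltnS leq_subr subKn //=.
by rewrite mulrCA exprVn expfB_cond ?(negPf z0).
Qed.
End IntegerMatrices.

Section RationalKernel.

Lemma common_denominator (m n : nat) (K : 'M[rat]_(m, n)) :
  exists (s : int) (N : 'M[int]_(m, n)), s != 0 /\ s%:~R *: K = map_mx intr N.
Proof.
pose s := \prod_i \prod_j denq (K i j).
exists s, (\matrix_(i, j) numq (s%:~R * K i j)); split.
  by apply/prodf_neq0 => i _; apply/prodf_neq0 => j _; rewrite denq_eq0.
apply/matrixP => i j; rewrite !mxE; apply/esym/numqK.
rewrite /s (bigD1 i) //= (bigD1 j) //= !rmorphM /=.
have numM (a b e k : rat) : a * b * e * k = k * a * b * e by ring.
by rewrite numM -numqE !rpredM ?intr_int.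
Qed.

(** The kernel of a rational matrix is defined over the rationals: extending
    the scalars adds no new relations. *)
Lemma ker_integral_span (F : numFieldType) n (Q : 'M[rat]_n) (c : 'rV[F]_n) :
  c *m map_mx ratr Q = 0 ->
  exists (N : 'M[int]_n) (d : 'rV[F]_n),
    map_mx intr N *m Q = 0 /\ c = d *m map_mx intr N.
Proof.
move/eqP; rewrite -sub_kermx -map_kermx => /submxP[d ->].
have [s [N [s0 sK]]] := common_denominator (kermx Q).
exists N, ((s%:~R)^-1 *: d); split.
  by rewrite -sK -scalemxAl mulmx_ker scaler0.
have -> : map_mx intr N = (s%:~R : F) *: map_mx ratr (kermx Q).
  rewrite -[LHS](_ : map_mx ratr (map_mx intr N : 'M[rat]_n) = _); last first.
    by apply/matrixP => i j; rewrite !mxE ratr_int.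
  by rewrite -sK; apply/matrixP => i j; rewrite !mxE rmorphM /= ratr_int.
by rewrite -scalemxAl -scalemxAr scalerA mulVf ?scale1r ?intr_eq0.
Qed.
End RationalKernel.

(** * Criteria for exponential growth *)

Section Growth.
Variable R : realType.

Lemma exprn_eventually_le (a e : R) : 0 <= a < 1 -> 0 < e ->
  exists N, forall n, (N <= n)%N -> a ^+ n <= e.
Proof.
move=> /andP[a0 a1] e0.
have : (fun n => a ^+ n) @ \oo --> (0 : R).
  by apply: cvg_expr; rewrite ger0_norm.
move=> /cvgrPdist_le /(_ e e0)[N _ NP]; exists N => n Nn.
by have := NP n Nn; rewrite /= sub0r normrN ger0_norm // exprn_ge0.
Qed.

(** The distance is [t ^+ n - u ^+ n], where [t] and [u] are the maximum and the
    minimum of [1] and [r], and both [(s / t) ^+ n] and [(u / t) ^+ n] tend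
    to 0. *)
Lemma exprn_le_dist1 (r s : R) : 0 <= r -> r != 1 -> 0 <= s < Num.max 1 r ->
  exists N, forall n, (N <= n)%N -> s ^+ n <= `|r ^+ n - 1|.
Proof.
move=> r0 r1 /andP[s0 st].
set t := Num.max 1 r; set u := Num.min 1 r.
have t0 : 0 < t by rewrite /t lt_max ltr01.
have u0 : 0 <= u by rewrite /u le_min ler01.
have ut : u < t.
  by rewrite /u /t; case: (ltgtP 1 r) r1 => [||->]; rewrite ?eqxx.
have distE n : `|r ^+ n - 1| = t ^+ n - u ^+ n.
  rewrite /u /t; case: (ltgtP 1 r) r1 => [h _|h _|->]; rewrite ?eqxx //= expr1n.
    by rewrite ger0_norm // subr_ge0 exprn_ege1 // ltW.
  by rewrite distrC ger0_norm // subr_ge0 exprn_ile1 // ltW.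
have frac v : 0 <= v -> v < t -> 0 <= v / t < 1.
  by move=> v0 vt; rewrite divr_ge0 ?(ltW t0) //= ltr_pdivrMr // mul1r.
have half0 : (0 : R) < 2^-1 by rewrite invr_gt0.
have [N1 N1P] := exprn_eventually_le (frac _ s0 st) half0.
have [N2 N2P] := exprn_eventually_le (frac _ u0 ut) half0.
exists (maxn N1 N2) => n; rewrite geq_max => /andP[/N1P h1 /N2P h2].
have tn0 : 0 < t ^+ n by rewrite exprn_gt0.
move: h1 h2; rewrite !expr_div_n !ler_pdivrMr // distE; lra.
Qed.

(** Exponential growth survives taking a fixed power or root, so it passes
    between functions that bound each other polynomially. *)
Lemma exponential_from_bounds (h : nat -> nat) (D : nat -> nat) (s b : R) N c :
  1 < s -> 1 < b -> (0 < c)%N ->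
  (forall n, (N <= n)%N -> s ^+ n <= (D n)%:R <= b ^+ n) ->
  (forall n, (N <= n)%N -> (D n <= h n ^ c)%N /\ (h n <= D n ^ c)%N) ->
  exponential_behaviour (fun n => (h n)%:R : R).
Proof.
move=> s1 b1 c0 Db hD; have s0 := lt_trans ltr01 s1.
have c0' : c%:R != 0 :> R by rewrite pnatr_eq0 -lt0n.
exists (s `^ c%:R^-1), (b ^+ c), N; split.
- rewrite -[ltLHS](_ : 1 `^ c%:R^-1 = 1); last by rewrite powR1.
  by apply: gt0_ltr_powR; rewrite ?invr_gt0 ?ltr0n // nnegrE ?ler01 // ltW.
- by rewrite exprn_egt1 // -lt0n.
move=> n Nn; have [Dh hDc] := hD n Nn; have /andP[D1 D2] := Db n Nn.
apply/andP; split.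
  rewrite -(@ler_pXn2r _ c) ?nnegrE ?exprn_ge0 ?powR_ge0 //.
  rewrite exprAC -(powR_mulrn c) ?powR_ge0 // -powRrM mulVf // powRr1 ?(ltW s0) //.
  by apply: le_trans D1 _; rewrite -natrX ler_nat.
rewrite exprAC; apply: le_trans (_ : (D n)%:R ^+ c <= _).
  by rewrite -natrX ler_nat.
by rewrite ler_pXn2r ?nnegrE ?exprn_ge0 // ltW // (lt_trans ltr01).
Qed.

End Growth.

(** * The period matrix and real coordinates *)

Section PeriodMatrix.
Variables (R : realType) (L : lattice R).
Local Notation C := (R[i] : numClosedFieldType).
Local Notation V := 'rV[C]_2.
Local Notation toC := (map_mx (real_complex R)).
Local Notation conjmx := (map_mx (@Num.conj C)).

Definition period_mx : 'M[C]_(4, 2) := \matrix_(i < 4) period L i.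
Local Notation Pi := period_mx.

Lemma mul_period_mx (c : 'rV[C]_4) : c *m Pi = \sum_i c 0 i *: period L i.
Proof. by rewrite mulmx_sum_row; apply: eq_bigr => i _; rewrite rowK. Qed.

Lemma period_mx_free (c : 'rV[R]_4) : toC c *m Pi = 0 -> c = 0.
Proof.
rewrite mul_period_mx => c0; apply/rowP => i; rewrite mxE.
apply: (@period_free _ L (c 0)); rewrite -[RHS]c0.
by apply: eq_bigr => j _; rewrite mxE.
Qed.

Lemma conj_fixed_real (z : 'rV[C]_4) : conjmx z = z -> {c | z = toC c}.
Proof.
move=> zr; exists (map_mx (@complex.Re R) z); apply/rowP => i; rewrite !mxE.
by rewrite RRe_real // CrealE -[X in _ == fun_of_matrix X _ _]zr mxE.
Qed.

Lemma conjmxK m n (A : 'M[C]_(m, n)) : conjmx (conjmx A) = A.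
Proof. by apply/matrixP => i j; rewrite !mxE conjCK. Qed.

(** A complex relation splits into two real ones. *)
Lemma periods_conj_free (z : 'rV[C]_4) :
  z *m Pi = 0 -> conjmx z *m Pi = 0 -> z = 0.
Proof.
move=> z0 z0'.
have real0 (x : 'rV[C]_4) : conjmx x = x -> x *m Pi = 0 -> x = 0.
  by move=> /conj_fixed_real[c ->] /period_mx_free ->; rewrite map_mx0.
have e1 : z + conjmx z = 0.
  by apply: real0; rewrite ?mulmxDl ?z0 ?z0' ?addr0 // map_mxD /= conjmxK addrC.
have e2 : 'i *: (z - conjmx z) = 0.
  apply: real0; last by rewrite -scalemxAl mulmxBl z0 z0' subr0 scaler0.
  by rewrite map_mxZ /= map_mxB /= conjmxK conjCi scaleNr -scalerN opprB.
have {}e2 : z - conjmx z = 0.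
  by move/eqP: e2; rewrite scaler_eq0 (negPf (neq0Ci _)) => /eqP.
have : z *+ 2 = 0
  by rewrite -[RHS]addr0 -{1}e1 -e2 addrACA subrr addr0 mulr2n.
by move/eqP; rewrite -scaler_nat scaler_eq0 pnatr_eq0 => /eqP.
Qed.

(** Adjoining the conjugates turns the period matrix into an invertible square
    matrix, whose inverse computes real coordinates in the basis of periods. *)
Definition full_period_mx : 'M[C]_4 :=
  (row_mx Pi (conjmx Pi) : 'M[C]_(4, 2 + 2)).
Local Notation S := full_period_mx.

Lemma mul_full_period m (z : 'M[C]_(m, 4)) :
  z *m S = row_mx (z *m Pi) (z *m conjmx Pi).
Proof. exact: (@mul_mx_row C m 4 2 2 z Pi (conjmx Pi)). Qed.

Lemma full_period_mx_unit : S \in unitmx.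
Proof.
rewrite unitmxE unitfE; apply/negP => /det0P[z z0 zS]; case/negP: z0; apply/eqP.
have /eq_row_mx[p1 p2] : row_mx (z *m Pi) (z *m conjmx Pi) = row_mx 0 0.
  by rewrite -mul_full_period zS row_mx0.
apply: periods_conj_free => //; apply: (can_inj (@conjmxK _ _)).
by rewrite map_mxM /= conjmxK p2 map_mx0.
Qed.

Lemma row_coordE (c : 'rV[R]_4) (v : V) : toC c *m Pi = v ->
  toC c = row_mx v (conjmx v) *m invmx S.
Proof.
move=> <-; apply: (canRL (mulmxK full_period_mx_unit)).
rewrite mul_full_period map_mxM /=; suff -> : conjmx (toC c) = toC c by [].
by apply/matrixP => i j; rewrite !mxE /= conj_Creal // complex_real.
Qed.

(** The coordinates given by the inverse of the full period matrix are fixed by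
    conjugation, by uniqueness. *)
Lemma row_coord (v : V) : exists c : 'rV[R]_4, toC c *m Pi = v.
Proof.
have [z [p1 p2]] : exists z, z *m Pi = v /\ z *m conjmx Pi = conjmx v.
  exists ((row_mx v (conjmx v) : 'M[C]_(1, 2 + 2)) *m invmx S).
  apply: eq_row_mx; rewrite -mul_full_period mulmxKV //.
  exact: full_period_mx_unit.
have zr : conjmx z = z.
  have zP : conjmx z *m Pi = v.
    by rewrite -[RHS]conjmxK -p2 map_mxM /= conjmxK.
  apply/subr0_eq/periods_conj_free.
    by rewrite mulmxBl zP p1 subrr.
  by rewrite map_mxB /= conjmxK mulmxBl zP p1 subrr.
by have [c zc] := conj_fixed_real zr; exists c; rewrite -zc.
Qed.

Lemma in_latticeP (c : 'rV[R]_4) :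
  in_lattice L (toC c *m Pi) <-> exists m : 'rV[int]_4, c = map_mx intr m.
Proof.
have intE (m : 'I_4 -> int) : \sum_i period L i *~ m i =
    toC (map_mx intr (\row_i m i)) *m Pi.
  rewrite mul_period_mx; apply: eq_bigr => i _.
  by rewrite !mxE rmorph_int scaler_int.
split=> [/asboolP[m]|[m ->]]; last first.
  apply/asboolP; exists (m 0); rewrite intE; congr (toC (map_mx intr _) *m _).
  by apply/rowP => i; rewrite mxE.
rewrite intE => /eqP; rewrite -subr_eq0 -mulmxBl -map_mxB => /eqP.
by move/period_mx_free/subr0_eq => ->; exists (\row_i m i).
Qed.

Lemma toTorus_eq0E (v : V) : toTorus L v = 0 <-> in_lattice L v.
Proof.
split; first exact: toTorus_eq0.
move=> vL; rewrite -(raddf0 (toTorus L)); apply/eqP.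
by rewrite -Quotient.idealrBE subr0.
Qed.

Lemma toTorus_surj (x : torus L) : exists v, toTorus L v = x.
Proof. by exists (repr x); rewrite /toTorus reprK. Qed.

(** Coordinates depend linearly on the vector, so a short lattice vector has
    integer coordinates of absolute value less than 1. *)
Lemma lattice_discrete : exists2 e : C, 0 < e &
  forall v, in_lattice L v -> `|v| < e -> v = 0.
Proof.
pose K : C := 1 + \sum_j \sum_i `|invmx S j i|.
have K0 : 0 < K.
  by rewrite ltr_pwDl // sumr_ge0 // => j _; rewrite sumr_ge0.
exists K^-1 => [|v vL vK]; first by rewrite invr_gt0.
have [c cv] := row_coord v; move: (vL); rewrite -cv.
move=> /in_latticeP[m cm]; suff -> : c = 0 by rewrite map_mx0 mul0mx.
rewrite cm; apply/rowP => i; rewrite !mxE.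
suff : `|(m 0 i)%:~R : C| < 1.
  by rewrite -intr_norm -[1]/(1%:~R) ltr_int => mi; suff -> : m 0 i = 0 by []; lia.
have entry j : `|v 0 j| <= K^-1.
  have : ball (0 : V) K^-1 v by rewrite -ball_normE /= sub0r normrN.
  by case=> _ /(_ 0 j); rewrite -ball_normE /= mxE sub0r normrN => /ltW.
have -> : (m 0 i)%:~R = (row_mx v (conjmx v) *m invmx S) 0 i.
  by rewrite -(row_coordE cv) cm !mxE rmorph_int.
rewrite mxE; apply: le_lt_trans (ler_norm_sum _ _ _) _.
apply: le_lt_trans (_ : K^-1 * (\sum_j \sum_i `|invmx S j i|) < 1); last first.
  by rewrite mulrC ltr_pdivrMr // mul1r /K ltrDr.
rewrite mulr_sumr; apply: ler_sum => j _; rewrite normrM ler_pM //.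
  case: (@split_ordP 2 2 j) => k ->.
    by rewrite (row_mxEl v (conjmx v)).
  by rewrite (row_mxEr v (conjmx v)) mxE norm_conjC.
by rewrite (bigD1 i) //= lerDl sumr_ge0.
Qed.
End PeriodMatrix.

(** * Linear lifts of endomorphisms *)

Section Lift.
Variables (R : realType) (L : lattice R).
Local Notation C := (R[i] : numClosedFieldType).
Local Notation V := 'rV[C]_2.

Lemma complex_archi (a b : C) : 0 <= a -> 0 < b ->
  exists n : nat, a < b *+ 2 ^ n.
Proof.
move=> a0 b0; have q0 : 0 <= a / b by rewrite divr_ge0 // ltW.
have qr : a / b = (complex.Re (a / b))%:C%C by rewrite RRe_real // ger0_real.
exists (Num.bound (complex.Re (a / b))).
rewrite -mulr_natl -ltr_pdivrMr // qr -(rmorph_nat (real_complex R)) ltcR.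
apply: lt_trans (archi_boundP _) _; first by rewrite -ler0c -qr.
by rewrite ltr_nat ltn_expl.
Qed.

Lemma scale_archi (v : V) (d : C) : 0 < d -> exists n : nat, exists2 u : V,
  v = u *+ 2 ^ n & `|u| < d.
Proof.
move=> d0; have [n vn] := complex_archi (normr_ge0 v) d0.
have n0 : (2 ^ n)%:R != 0 :> C by rewrite pnatr_eq0 expn_eq0.
exists n, ((2 ^ n)%:R^-1 *: v); first by rewrite -scaler_nat scalerA divff ?scale1r.
rewrite normrZ normfV normr_nat.
by rewrite mulrC ltr_pdivrMr ?mulr_natr // ltr0n expn_gt0.
Qed.

(** A local lift [G] of an endomorphism with [G 0 = 0] satisfies
    [G (2 w) = 2 G w] near [0], because the two sides differ by a small element
    of a discrete group. Hence [G w = 2 ^ n G (w / 2 ^ n)], which tends to the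
    value at [w] of the differential of [G] at [0]; so [G] is linear, and
    divisibility of the torus carries this over to all of it. *)
Lemma endo_lift (f : endo L) :
  exists A : 'M[C]_2, forall v, f (toTorus L v) = toTorus L (v *m A).
Proof.
have /asboolP[fD fh] := endoP f.
have f0 : f 0 = 0 by apply: (addrI (f 0)); rewrite -fD !addr0.
have fE x n : f (x *+ n) = f x *+ n.
  by elim: n => [|n IHn]; rewrite ?f0 // !mulrS fD IHn.
have torusMn v n : toTorus L (v *+ n) = toTorus L v *+ n by exact: raddfMn.
have [F [Fd FE]] := fh 0; have Fd0 := nbhs_singleton Fd.
have [e e0 eL] := lattice_discrete L.
(* [F 0] is a lattice vector, so that [G] is a local lift of [f] as well. *)
pose G w := F w - F 0.
have [d /= d0 dP] : exists2 d : C, 0 < d & forall w, `|w| < d ->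
    toTorus L (G w) = f (toTorus L w) /\ `|G w| < e / 3.
  have e3 : 0 < e / 3 by rewrite divr_gt0 ?ltr0n.
  have /cvgr_dist_lt/(_ _ e3) F3 := differentiable_continuous Fd0.
  have : \forall w \near (0 : V), toTorus L (F w) = f (toTorus L w) /\
      `|F 0 - F w| < e / 3 by apply: filterS2 FE F3.
  move=> /nbhs_norm0P[d /= d0 dP].
  exists d => // w /dP[Fw]; rewrite distrC; split=> //.
  rewrite /G toTorus_is_additive Fw (nbhs_singleton FE).
  by rewrite (raddf0 (toTorus L)) f0 subr0.
pose A := lin1_mx ('d F 0).
have Gdiff (h : C) : 0 < h -> exists2 d : C, 0 < d &
    forall w, `|w| < d -> `|G w - w *m A| <= h * `|w|.
  move=> h0; have /eqaddoP/(_ _ h0)/nbhs_norm0P[r /= r0 rP] := diff_locally Fd0.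
  exists r => // w /rP; rewrite /= !fctE /= /shift /= addr0 mul_rV_lin1.
  by rewrite opprD addrA.
have Gdouble w : `|w *+ 2| < d -> G (w *+ 2) = G w *+ 2.
  move=> w2; have w1 : `|w| < d.
    by apply: le_lt_trans w2; rewrite normrMn mulr2n lerDl.
  have [[E1 h1] [E2 h2]] := (dP _ w1, dP _ w2); apply/subr0_eq/eL.
    apply/toTorus_eq0E.
    by rewrite toTorus_is_additive E2 !torusMn E1 fE subrr.
  apply: le_lt_trans (ler_normB _ _) _; rewrite normrMn [(`|G w| *+ 2)%R]mulr2n.
  have e3E : e = e / 3 + (e / 3 + e / 3) by field.
  by rewrite [ltRHS]e3E !ltrD.
have Gdouble_n n w : `|w *+ 2 ^ n| < d -> G (w *+ 2 ^ n) = G w *+ 2 ^ n.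
  elim: n w => [|n IHn] w; first by rewrite !mulr1n.
  rewrite expnSr !mulrnA => wd; rewrite Gdouble // IHn //.
  by apply: le_lt_trans wd; rewrite [leRHS]normrMn mulr2n lerDl.
have AMn (u : V) n : (u *+ n) *m A = (u *m A) *+ n.
  by rewrite -(scaler_nat n u) -scalemxAl scaler_nat.
have Glin w : `|w| < d -> G w = w *m A.
  move=> wd; apply/eqP; rewrite -subr_eq0 -normr_eq0; apply/negP => /negP nz.
  have w0 : 0 < `|w|.
    rewrite normr_gt0; apply: contraNneq nz => ->.
    by rewrite /G subrr mul0mx subr0 normr0.
  (* This error bound for the differential, once scaled up from [w / 2 ^ n] to
     [w], says that [G w - w *m A] is at most half its own norm. *)
  pose h := `|G w - w *m A| / (`|w| *+ 2).
  have h0 : 0 < h by rewrite divr_gt0 ?pmulrn_lgt0 // lt_def nz normr_ge0.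
  have [d' d'0 Gd'] := Gdiff h h0; have [n [u wE ud']] := scale_archi w d'0.
  have := Gd' u ud'; rewrite -(ler_pMn2r (_ : 0 < 2 ^ n)%N) ?expn_gt0 //.
  rewrite -mulrnAr -!normrMn mulrnBl -Gdouble_n -?wE // -AMn -wE.
  have hw : h * `|w| = `|G w - w *m A| / 2.
    by rewrite /h -mulr_natr; field; rewrite gt_eqF.
  rewrite hw ler_pdivlMr ?ltr0n // mulr_natr mulr2n gerDl.
  by rewrite lt_geF // lt_def nz normr_ge0.
exists A => v; have [n [u -> ud]] := scale_archi v d0.
by rewrite torusMn fE -(dP u ud).1 Glin // -torusMn AMn.
Qed.
End Lift.

(** * Analytic and rational representations *)

Section Representations.
Variables (R : realType) (L : lattice R).
Local Notation C := (R[i] : numClosedFieldType).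
Local Notation V := 'rV[C]_2.
Local Notation toC := (map_mx (real_complex R)).
Local Notation conjmx := (map_mx (@Num.conj C)).
Local Notation Pi := (period_mx L).

(** Vectors are rows and matrices act on the right, so that a composite of maps
    is lifted by the product in the opposite order. *)
Definition lifts (h : torus L -> torus L) (A : 'M[C]_2) :=
  forall v, h (toTorus L v) = toTorus L (v *m A).

(** [M] is the matrix, in the basis of periods, of the map that [A] induces on
    the lattice. *)
Definition represents (M : 'M[int]_4) (A : 'M[C]_2) :=
  map_mx intr M *m Pi = Pi *m A.

Lemma toC_intr m n (N : 'M[int]_(m, n)) :
  toC (map_mx intr N) = map_mx intr N :> 'M[C]_(m, n).
Proof. by apply/matrixP => i j; rewrite !mxE rmorph_int. Qed.

Lemma in_lattice_intP (v : V) :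
  in_lattice L v <-> exists m : 'rV[int]_4, map_mx intr m *m Pi = v.
Proof.
have [c <-] := row_coord L v; rewrite in_latticeP; split=> -[m mE]; exists m.
  by rewrite mE toC_intr.
by move/eqP: mE; rewrite -toC_intr -subr_eq0 -mulmxBl -map_mxB =>
  /eqP/period_mx_free/subr0_eq.
Qed.

Lemma lifts_represented h A : lifts h A -> exists M, represents M A.
Proof.
move=> hA; have h0 : h 0 = 0.
  by rewrite -(raddf0 (toTorus L)) hA mul0mx.
have rowP i : exists m : 'rV[int]_4, map_mx intr m *m Pi = row i (Pi *m A).
  apply/in_lattice_intP/toTorus_eq0E; rewrite row_mul -hA -h0; congr (h _).
  apply/toTorus_eq0E/in_lattice_intP; exists (row i 1%:M).
  by rewrite map_row map_mx1 -row_mul mul1mx.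
have [m mP] := choice rowP.
exists (\matrix_i m i); apply/row_matrixP => i.
by rewrite -mP row_mul -map_row rowK.
Qed.

(** [A - B] maps the whole space linearly into the lattice, where no nonzero
    vector can be divided indefinitely by 2. *)
Lemma lifts_inj h A B : lifts h A -> lifts h B -> A = B.
Proof.
move=> hA hB; have [e e0 eL] := lattice_discrete L.
suff vAB (v : V) : v *m (A - B) = 0.
  by apply/subr0_eq/row_matrixP => i; rewrite -[A - B]mul1mx row_mul vAB row0.
have [n [u uE ue]] := scale_archi (v *m (A - B)) e0.
have n0 : (2 ^ n)%:R != 0 :> C by rewrite pnatr_eq0 expn_eq0.
rewrite uE (eL u) ?mul0rn //.
have -> : u = ((2 ^ n)%:R^-1 *: v) *m (A - B).
  by rewrite -scalemxAl uE -(scaler_nat _ u) scalerA mulVf ?scale1r.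
by apply/toTorus_eq0E; rewrite mulmxBr toTorus_is_additive -hA -hB subrr.
Qed.

Lemma lifts_eq h g A : lifts h A -> lifts g A -> h = g.
Proof.
by move=> hA gA; apply/funext => x; have [v <-] := toTorus_surj x; rewrite hA gA.
Qed.

Lemma lifts_iter h A n : lifts h A -> lifts (iter n h) (A ^+ n).
Proof.
move=> hA; elim: n => [|n IHn] v; first by rewrite expr0 mulmx1.
by rewrite iterS IHn hA exprSr mulmxA.
Qed.

Lemma mulmx_horner_mx (X : 'M[C]_4) (A : 'M[C]_2) q :
  X *m Pi = Pi *m A -> horner_mx X q *m Pi = Pi *m horner_mx A q.
Proof.
move=> XA; elim/poly_ind: q => [|q c IHq]; first by rewrite !rmorph0 mul0mx mulmx0.
rewrite !rmorphD !rmorphM /= !horner_mx_X !horner_mx_C mulmxDl mulmxDr.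
by rewrite -mulmxA XA mulmxA IHq mulmxA mul_scalar_mx mul_mx_scalar.
Qed.

Lemma ratr_intr_mx m n (N : 'M[int]_(m, n)) :
  map_mx ratr (map_mx intr N) = map_mx intr N :> 'M[C]_(m, n).
Proof. by apply/matrixP => i j; rewrite !mxE ratr_int. Qed.

(** The kernel of [p(A)] is the tangent space of a subtorus: in real coordinates
    it is the kernel of the rational matrix [p(M)], which is spanned by integer
    vectors. *)
Lemma simple_horner_mx0 (hS : simple_surface L) M A (p : {poly rat}) :
  represents M A -> \det (horner_mx A (map_poly ratr p)) = 0 ->
  horner_mx A (map_poly ratr p) = 0.
Proof.
move=> MA /eqP/det0P[v v0 vB]; set B := horner_mx _ _ in vB *.
pose W := lker (linfun (mulmxr B : V -> V)).
have inW w : (w \in W) = (w *m B == 0) by rewrite memv_ker lfunE.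
pose Q : 'M[rat]_4 := horner_mx (map_mx intr M) p.
have QB : map_mx ratr Q *m Pi = Pi *m B.
  by rewrite map_horner_mx ratr_intr_mx; exact: mulmx_horner_mx MA.
have /hS[W0|WT] : is_subtorus L W.
  move=> w; rewrite inW => /eqP wB; have [c cw] := row_coord L w.
  have : c *m map_mx ratr Q = 0.
    apply: (@period_mx_free _ L); rewrite map_mxM /= -map_mx_comp.
    rewrite (eq_map_mx _ (fmorph_eq_rat _)) -mulmxA QB mulmxA cw.
    exact: wB.
  move=> /ker_integral_span[N [d [NQ cE]]].
  exists 4%N, (d 0), (fun k => row k (map_mx intr N) *m Pi); split=> [k|].
    split.
      rewrite inW -mulmxA -QB mulmxA -row_mul -ratr_intr_mx.
      by rewrite -map_mxM NQ map_mx0 row0 mul0mx.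
    by apply/in_lattice_intP; exists (row k N); rewrite map_row.
  rewrite -cw cE map_mxM toC_intr (mulmx_sum_row (toC d)) mulmx_suml.
  by apply: eq_bigr => k _; rewrite mxE scalemxAl.
  by case/negP: v0; rewrite -memv0 -W0 inW vB.
apply/row_matrixP => i; rewrite row0 rowE; apply/eqP.
by rewrite -inW WT memvf.
Qed.

(** The full period matrix conjugates [M] to the direct sum of [A] and its
    complex conjugate. *)
Lemma char_poly_represents M A (rs : seq C) : represents M A ->
  char_poly A = \prod_(z <- rs) ('X - z%:P) ->
  char_poly (map_mx intr M) =
    \prod_(z <- rs ++ map Num.conj rs) ('X - z%:P).
Proof.
move=> MA chA; pose B : 'M[C]_(2 + 2) := block_mx A 0 0 (conjmx A).
pose S := full_period_mx L.
have MS : map_mx intr M *m S = S *m B.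
  rewrite mul_full_period.
  transitivity (row_mx (Pi *m A) (conjmx Pi *m conjmx A)); last first.
    apply/esym.
    have := @mul_row_block C 4 2 2 2 2 Pi (conjmx Pi) A 0 0 (conjmx A).
    by rewrite !mulmx0 addr0 add0r.
  have MA' : map_mx intr M *m conjmx Pi = conjmx Pi *m conjmx A.
    rewrite -map_mxM -MA map_mxM; congr (_ *m _).
    by apply/matrixP => i j; rewrite !mxE rmorph_int.
  by rewrite MA MA'.
have chB : char_poly B = char_poly A * char_poly (conjmx A).
  by rewrite /char_poly char_block_diag_mx det_ublock.
transitivity (char_poly B).
  apply: poly_natP => k; rewrite !horner_char_poly.
  have S0 : \det S != 0 by rewrite -unitfE -unitmxE full_period_mx_unit.
  apply: (mulIf S0); rewrite -det_mulmx [RHS]mulrC -det_mulmx; congr (\det _).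
  by rewrite mulmxBl mulmxBr MS mul_scalar_mx mul_mx_scalar.
rewrite chB big_cat chA; congr (_ * _); rewrite -map_char_poly chA rmorph_prod big_map.
by apply: eq_bigr => z _; rewrite /= map_polyXsubC.
Qed.
End Representations.

(** * Counting fixed points *)

Section FixedPoints.
Variables (R : realType) (L : lattice R).
Local Notation C := (R[i] : numClosedFieldType).
Local Notation V := 'rV[C]_2.
Local Notation toC := (map_mx (real_complex R)).
Local Notation Pi := (period_mx L).
Local Notation pt c := (toTorus L (toC c *m Pi)).
Variables (h : torus L -> torus L) (A : 'M[C]_2) (M : 'M[int]_4).
Hypotheses (hA : lifts h A) (MA : represents L M A).
Let X : 'M[int]_4 := M - 1%:M.
Hypothesis X0 : \det X != 0.

(** Fixed points of [h] are the kernel of [h - 1], which acts on real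
    coordinates as [X]. *)
Lemma fixed_pointP (c : 'rV[R]_4) :
  h (pt c) = pt c <-> exists m : 'rV[int]_4, c *m map_mx intr X = map_mx intr m.
Proof.
rewrite -(in_latticeP L) -toTorus_eq0E map_mxM /= toC_intr -mulmxA.
have -> : map_mx intr X *m Pi = Pi *m (A - 1%:M).
  by rewrite /X map_mxB map_mx1 mulmxBl mulmxBr MA mul1mx mulmx1.
rewrite mulmxA mulmxBr mulmx1 toTorus_is_additive hA.
by split=> [->|/subr0_eq]; rewrite ?subrr.
Qed.

Lemma liftsD x y : h (x + y) = h x + h y.
Proof.
have [[u <-] [v <-]] := (toTorus_surj x, toTorus_surj y).
by rewrite -(raddfD (toTorus L)) !hA mulmxDl (raddfD (toTorus L)).
Qed.

(** Fixed points are killed by [det X], because [adj X] inverts [X] up to that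
    factor; their coordinates can be taken in [(1 / det X) Z / Z]. *)
Lemma fixed_point_torsion x : h x = x ->
  exists r : 'rV['I_`|\det X|]_4,
    x = pt (\row_i ((r 0 i : nat)%:R / (\det X)%:~R)).
Proof.
have [v <-] := toTorus_surj x; have [c <-] := row_coord L v.
move=> /fixed_pointP[m mE].
pose d := \det X; have d0 : d%:~R != 0 :> R by rewrite intr_eq0.
have [m' cE] : exists m' : 'rV[int]_4, c *m d%:~R%:M = map_mx intr m'.
  exists (m *m \adj X); rewrite map_mxM -mE -mulmxA -map_mxM mul_mx_adj.
  by rewrite map_scalar_mx.
pose u i := m' 0 i.
have ltd i : (absz (u i %% d)%Z < `|d|)%N.
  by rewrite -ltz_nat gez0_abs ?modz_ge0 // ltz_mod.
exists (\row_i Ordinal (ltd i)).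
apply/subr0_eq; rewrite -toTorus_is_additive -mulmxBl -map_mxB.
apply/toTorus_eq0E/in_latticeP; exists (\row_i (u i %/ d)%Z).
apply/rowP => i; rewrite !mxE /=.
have := congr1 (fun w : 'rV[R]_4 => w 0 i) cE.
rewrite mul_mx_scalar !mxE -/(u i) => cE'.
apply: (mulfI d0); rewrite mulrBr cE' mulrCA divff // mulr1.
rewrite -[X in _ - X](_ : ((u i %% d)%Z)%:~R = _); last first.
  by rewrite -[in LHS](gez0_abs (modz_ge0 _ X0)).
rewrite -rmorphB /= -rmorphM /=; congr (_%:~R).
by rewrite [X in X - _](divz_eq (u i) d) addrK mulrC.
Qed.

Lemma fixed_points_seq : {subset (fset_set [set x | h x = x]) <=
   [seq pt (\row_i ((r 0 i : nat)%:R / (\det X)%:~R)) | r : 'rV['I_`|\det X|]_4]}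
  /\ finite_set [set x | h x = x].
Proof.
set s := [seq _ | r : _]; have fin : finite_set [set x | h x = x].
  apply: (@sub_finite_set _ _ [set` s]); last exact: finite_seq.
  by move=> x /= /fixed_point_torsion[r ->]; apply: map_f; rewrite mem_enum.
split=> // x; rewrite in_fset_set // inE => /fixed_point_torsion[r ->].
by apply: map_f; rewrite mem_enum.
Qed.

Lemma nb_fix_le : (nb_fix h <= `|\det X| ^ 4)%N.
Proof.
have [sub _] := fixed_points_seq.
apply: leq_trans (uniq_leq_size (fset_uniq _) sub) _.
by rewrite size_map -cardE card_mx card_ord mul1n.
Qed.

Lemma mem_fixed x : (x \in fset_set [set x | h x = x]) = (h x == x).
Proof.
rewrite in_fset_set; last by case: fixed_points_seq.
by apply/idP/eqP; rewrite inE.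
Qed.

(** Lagrange's theorem for the group of fixed points: translation by [x]
    permutes it and so preserves the sum of its elements. *)
Lemma fixed_point_order x : h x = x -> x *+ nb_fix h = 0.
Proof.
move=> hx; rewrite /nb_fix; set s := fset_set _.
have : \sum_(y <- s) y = \sum_(y <- s) (x + y).
  rewrite -(big_map (fun y => x + y) xpredT id); apply: perm_big.
  apply: uniq_perm; first exact: fset_uniq.
    by rewrite map_inj_uniq ?fset_uniq //; exact: addrI.
  move=> y; apply/idP/mapP => [ys|[z zs ->]]; last first.
    by move: zs; rewrite !mem_fixed liftsD hx => /eqP ->.
  exists (y - x); last by rewrite addrC subrK.
  move: ys; rewrite !mem_fixed => /eqP hy.
  by apply/eqP/(addIr x); rewrite subrK -{2}hx -liftsD subrK.
rewrite big_split /= big_const_seq count_predT iter_addr_0.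
by rewrite -[LHS]add0r => /addIr <-.
Qed.

(** The rows of the inverse of [X] are coordinates of fixed points, so their
    multiples by the number [k] of fixed points are integral; [k X^-1] is an
    integer matrix, and [det X] divides [k ^ 4]. *)
Lemma det_le_nb_fix : (`|\det X| <= nb_fix h ^ 4)%N.
Proof.
set k := nb_fix h.
have k0 : (0 < k)%N.
  rewrite /k /nb_fix finmap.cardfs_gt0; apply/finmap.fset0Pn; exists 0.
  by rewrite mem_fixed -{1}(raddf0 (toTorus L)) hA mul0mx (raddf0 (toTorus L)).
pose Y : 'M[R]_4 := map_mx intr X.
have YU : Y \in unitmx by rewrite unitmxE unitfE det_map_mx intr_eq0.
have rowP i : exists m : 'rV[int]_4, row i (invmx Y *+ k) = map_mx intr m.
  have /fixed_point_order : h (pt (row i (invmx Y))) = pt (row i (invmx Y)).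
    apply/fixed_pointP; exists (row i 1%:M).
    by rewrite -row_mul mulVmx // map_row map_mx1.
  rewrite -/k -(raddfMn (toTorus L)) => /toTorus_eq0E.
  have -> : toC (row i (invmx Y)) *m Pi *+ k = toC (row i (invmx Y *+ k)) *m Pi.
    have -> : toC (row i (invmx Y *+ k)) = k%:R *: toC (row i (invmx Y)).
      by rewrite scaler_nat !raddfMn.
    by rewrite -scalemxAl scaler_nat.
  by move/in_latticeP.
have [m mP] := choice rowP; pose N : 'M[int]_4 := \matrix_i m i.
have NE : map_mx intr N = invmx Y *+ k.
  by apply/row_matrixP => i; rewrite mP -map_row rowK.
have XN : X *m N = k%:R%:M.
  have XNR : map_mx intr (X *m N) = map_mx intr (k%:R%:M) :> 'M[R]_4.
    rewrite map_mxM NE -/Y -scaler_nat -scalemxAr mulmxV // scalemx1.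
    by rewrite map_scalar_mx rmorph_nat; exact: erefl.
  apply/matrixP => i j; apply: (@intr_inj R).
  by have := congr1 (fun Z : 'M[R]_4 => Z i j) XNR; rewrite ![map_mx _ _ i j]mxE.
have := congr1 determinant XN; rewrite det_mulmx det_scalar => dE.
have : (`|\det X| %| k ^ 4)%N.
  by apply/dvdnP; exists `|\det N|%N; rewrite mulnC -abszM dE; lia.
by apply: dvdn_leq; rewrite expn_gt0 k0.
Qed.
End FixedPoints.

(** * Eigenvalues on a simple torus *)

Section Spectrum.
Variables (R : realType) (L : lattice R) (hS : simple_surface L).
Local Notation C := (R[i] : numClosedFieldType).
Variables (M : 'M[int]_4) (A : 'M[C]_2) (rs : seq C).
Hypotheses (MA : represents L M A).
Hypothesis chA : char_poly A = \prod_(z <- rs) ('X - z%:P).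

(** The minimal polynomial has the same roots as the characteristic one. *)
Lemma horner_mx0_spectrum (q : {poly C}) z :
  horner_mx A q = 0 -> z \in rs -> root q z.
Proof.
move=> /mxminpoly_min/dvdpP[u ->] zrs; rewrite rootM root_mxminpoly.
by rewrite chA root_prod_XsubC zrs orbT.
Qed.

(** A root of [p] among the eigenvalues makes [p(A)] singular, and on a simple
    torus a singular endomorphism is zero. *)
Lemma horner_mx0_of_root (p : {poly rat}) z :
  z \in rs -> root (map_poly ratr p) z -> horner_mx A (map_poly ratr p) = 0.
Proof.
move=> zrs /rootP pz; apply: (simple_horner_mx0 hS MA).
rewrite (det_horner_mx chA); apply/eqP; rewrite prodf_seq_eq0.
by apply/hasP; exists z; rewrite //= pz.
Qed.

Lemma root_spectrum (p : {poly rat}) w z : w \in rs -> z \in rs ->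
  root (map_poly ratr p) w -> root (map_poly ratr p) z.
Proof. by move=> wrs zrs /(horner_mx0_of_root wrs)/horner_mx0_spectrum; exact. Qed.

Let rsM := rs ++ map Num.conj rs.

Lemma mem_conj_spectrum z : z \in rs -> z^* \in rsM.
Proof. by move=> zrs; rewrite mem_cat map_f ?orbT. Qed.

Lemma map_char_poly_represents :
  map_poly ratr (char_poly (map_mx intr M : 'M[rat]_4)) =
  \prod_(z <- rsM) ('X - z%:P) :> {poly C}.
Proof.
by rewrite map_char_poly ratr_intr_mx (char_poly_represents MA chA).
Qed.

Lemma root_char_poly_represents z :
  root (map_poly ratr (char_poly (map_mx intr M : 'M[rat]_4))) z = (z \in rsM).
Proof. by rewrite map_char_poly_represents root_prod_XsubC. Qed.

Lemma spectrum_neq0 z : A != 0 -> z \in rs -> z != 0.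
Proof.
move=> A0 zrs; apply: contraNneq A0 => z0.
have := @horner_mx0_of_root 'X z zrs; rewrite map_polyX horner_mx_X.
by move=> /(_ _)/eqP; apply; rewrite z0 rootX.
Qed.

(** If [w] is on the unit circle then [w^-1 = w^*] is an eigenvalue of [M]. This
    is a rational condition on [w], so [z^-1] is an eigenvalue of [M] as well.
    As [A] has only two eigenvalues, [z^-1] must have the absolute value of [z]
    or of [w]. *)
Lemma unit_circle_spectrum w z : A != 0 -> w \in rs -> z \in rs ->
  `|w| = 1 -> `|z| = 1.
Proof.
move=> A0 wrs zrs w1; have [w0 z0] := (spectrum_neq0 A0 wrs, spectrum_neq0 A0 zrs).
pose p := char_poly (map_mx intr M : 'M[rat]_4).
have sp : (size p <= 5)%N by rewrite size_char_poly.
have : root (map_poly ratr (\poly_(i < 5) p`_(4 - i))) z.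
  apply: (root_spectrum wrs zrs); apply/rootP.
  rewrite (horner_rev_poly sp) //; apply/eqP; rewrite mulf_eq0 -rootE.
  rewrite root_char_poly_represents -[w^-1](_ : w^* = _) ?mem_conj_spectrum ?orbT //.
  by apply: (mulIf w0); rewrite mulVf // mulrC -normCK w1 expr1n.
rewrite rootE (horner_rev_poly sp) // mulf_eq0 expf_eq0 (negPf z0) andbF /=.
rewrite -rootE root_char_poly_represents => zV.
have [y yrs yz] : exists2 y, y \in rs & `|z|^-1 = `|y|.
  rewrite -normfV; move: zV; rewrite mem_cat => /orP[zrsV|/mapP[y yrs ->]].
    by exists z^-1.
  by exists y; rewrite ?norm_conjC.
have self : `|z|^-1 = `|z| -> `|z| = 1.
  move=> zz; apply/eqP; rewrite -(@pexpr_eq1 _ _ 2) ?normr_ge0 // expr2.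
  by rewrite -{1}zz mulVf // normr_eq0.
have other : `|z|^-1 = `|w| -> `|z| = 1.
  by rewrite w1 => /eqP; rewrite invr_eq1 => /eqP.
have := size_spectrum chA; case: (rs) wrs zrs yrs => [|a [|b []]] //.
rewrite !inE => /orP[]/eqP wE /orP[]/eqP zE /orP[]/eqP yE _; subst w z y; auto.
Qed.

(** Coinciding powers of [w] give a root of unity, and [X ^ k - 1], vanishing at
    [w], annihilates [A]. Thus [A] has finite order, not only its
    eigenvalues. *)
Lemma finite_order_of_unit_circle w : A != 0 -> w \in rs -> `|w| = 1 ->
  exists2 k, (0 < k)%N & A ^+ k = 1.
Proof.
move=> A0 wrs w1; have w0 := spectrum_neq0 A0 wrs.
have all1 : all (fun z => `|z| <= 1) rsM.
  apply/allP => z; rewrite mem_cat => /orP[zrs|/mapP[y yrs ->]].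
    by rewrite (unit_circle_spectrum A0 wrs zrs w1).
  by rewrite norm_conjC (unit_circle_spectrum A0 wrs yrs w1).
have wM : w \in rsM by rewrite mem_cat wrs.
have [k [l [kl wkl]]] :=
  int_spectrum_expr_collide (char_poly_represents MA chA) all1 wM.
exists (l - k)%N; first by rewrite subn_gt0.
have := @horner_mx0_of_root ('X^(l - k) - 1) w wrs.
rewrite rmorphB /= map_polyXn rmorph1 rmorphB /= rmorphXn /= horner_mx_X rmorph1.
move=> pA; apply/subr0_eq/pA; rewrite rootE !hornerE subr_eq0.
apply/eqP/(mulfI (expf_neq0 k w0)); rewrite -exprD mulr1.
by rewrite subnKC ?wkl // ltnW.
Qed.

Lemma det_expr_sub1 n :
  (\det (M ^+ n - 1%:M))%:~R = (\prod_(z <- rs) `|z ^+ n - 1|) ^+ 2 :> C.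
Proof.
have -> : (\det (M ^+ n - 1%:M))%:~R =
    \det (horner_mx (map_mx intr M) ('X^n - 1)) :> C.
  rewrite -det_map_mx map_mxB map_mx1 rmorphXn rmorphB rmorphXn /= horner_mx_X.
  by rewrite (rmorph1 (horner_mx (map_mx intr M))).
rewrite (det_horner_mx (char_poly_represents MA chA)) big_cat big_map /=.
rewrite expr2 -!big_split /=; apply: eq_bigr => z _.
by rewrite !hornerE -rmorphXn -[1 in X in _ * X]conjC1 -rmorphB -normCK expr2.
Qed.
End Spectrum.

(** * Finite order or exponential growth *)

Section Dichotomy.
Variables (R : realType) (L : lattice R) (hS : simple_surface L).
Local Notation C := (R[i] : numClosedFieldType).
Local Notation nrm z := (complex.Re `|z|).

Lemma normCE (z : R[i]) : `|z| = (nrm z)%:C%C.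
Proof. by rewrite RRe_real // normr_real. Qed.

Lemma norm_real_complex (x : R) : `|x%:C%C| = `|x|%:C%C.
Proof. by rewrite normc_def /= expr0n addr0 sqrtr_sqr. Qed.

Lemma nrm_ge0 (z : R[i]) : 0 <= nrm z.
Proof. by rewrite -ler0c -normCE. Qed.

Lemma nrm_eq1 (z : R[i]) : (nrm z == 1) = (`|z| == 1).
Proof. by rewrite normCE -(rmorph1 (real_complex R)) (inj_eq (@complexI _)). Qed.

Lemma nrm_dist1 (z : R[i]) n :
  `|nrm z ^+ n - 1| <= nrm (z ^+ n - 1) <= nrm z ^+ n + 1.
Proof.
have nE : (nrm z ^+ n)%:C%C = `|z ^+ n| by rewrite rmorphXn /= -normCE normrX.
rewrite -!lecR -!normCE rmorphD /= nE rmorph1; apply/andP; split; last first.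
  by rewrite -[X in _ <= _ + X](normr1 R[i]) ler_normB.
have -> : `|nrm z ^+ n - 1|%:C%C = `|(nrm z ^+ n - 1)%:C%C|.
  by rewrite norm_real_complex.
rewrite rmorphB /= nE rmorph1 -[X in _ - X](normr1 R[i]); exact: ler_dist_dist.
Qed.

(** The rates have to stay strictly below the maxima for [exprn_le_dist1] to
    apply, and their product above 1 for the resulting lower bound to grow. *)
Lemma growth_rates (r1 r2 : R) : 1 < r1 \/ 1 < r2 ->
  exists s1 s2, [/\ 0 <= s1 < Num.max 1 r1, 0 <= s2 < Num.max 1 r2 & 1 < s1 * s2].
Proof.
have rates (r : R) : 1 < r -> exists s1 s2, [/\ 0 <= s1 < r, 0 <= s2 < 1 & 1 < s1 * s2].
  move=> r_gt1; pose s := (1 + r) / 2; have s1 : 1 < s by rewrite /s; lra.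
  have s0 := lt_trans ltr01 s1; have V0 : 0 < s^-1 by rewrite invr_gt0.
  have V1 : s^-1 < 1 by rewrite invf_lt1.
  exists s, ((1 + s^-1) / 2); split; first by rewrite /s; lra.
    by lra.
  by rewrite mulrA mulrDr mulr1 divff ?gt_eqF //; lra.
case=> /rates[s1 [s2 [/andP[h1 h2] /andP[h3 h4] h5]]]; [exists s1, s2|exists s2, s1].
  by split; rewrite ?h1 ?h3 ?lt_max ?h2 ?h4 ?orbT.
by rewrite mulrC; split; rewrite ?h1 ?h3 ?lt_max ?h2 ?h4 ?orbT.
Qed.

Lemma represents_expr M A n : represents L M A -> represents L (M ^+ n) (A ^+ n).
Proof.
rewrite /represents => MA; rewrite rmorphXn /=.
by have := mulmx_horner_mx 'X^n MA; rewrite !rmorphXn /= !horner_mx_X.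
Qed.

(** The determinant that controls the number of fixed points of the [n]-th
    iterate is the product of the [|z ^ n - 1| ^ 2], and at least one of the
    eigenvalues lies outside the unit disc. *)
Lemma exponential_of_spectrum (h : torus L -> torus L) M A (a b : C) :
  lifts h A -> represents L M A -> A != 0 ->
  char_poly A = \prod_(z <- [:: a; b]) ('X - z%:P) ->
  `|a| != 1 -> `|b| != 1 ->
  exponential_behaviour (fun n => (nb_fix (iter n h))%:R : R).
Proof.
move=> hA MA A0 chA a1 b1.
pose D n := `|\det (M ^+ n - 1%:M)|%N.
have DE n : (D n)%:R = (nrm (a ^+ n - 1) * nrm (b ^+ n - 1)) ^+ 2 :> R.
  apply: (@complexI R); rewrite rmorph_nat rmorphXn rmorphM /= -!normCE.
  have := det_expr_sub1 MA chA n; rewrite big_cons big_seq1 => dE.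
  rewrite -dE /D -[LHS](_ : `|(\det (M ^+ n - 1%:M))%:~R : C| = _); last first.
    by rewrite -intr_norm -abszE.
  by rewrite dE ger0_norm // exprn_ge0 // mulr_ge0.
have ra : nrm a != 1 by rewrite nrm_eq1.
have rb : nrm b != 1 by rewrite nrm_eq1.
have [ars brs] : a \in [:: a; b] /\ b \in [:: a; b] by rewrite !inE !eqxx orbT.
(* [det M] is a nonzero integer, of absolute value [(|a| |b|) ^ 2]. *)
have ab1 : 1 < nrm a \/ 1 < nrm b.
  have dE : (\det M)%:~R = ((nrm a * nrm b) ^+ 2)%:C%C :> C.
    have := det_horner_mx (char_poly_represents MA chA) 'X.
    rewrite horner_mx_X det_map_mx => ->; rewrite big_cat big_map /=.
    rewrite !big_cons !big_nil !hornerX !mulr1 rmorphXn rmorphM /= -!normCE.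
    by rewrite mulrACA -!normCK exprMn.
  have dM : (1 <= `|\det M|)%N.
    rewrite absz_gt0 -(intr_eq0 C) dE -(rmorph0 (real_complex R)).
    rewrite (inj_eq (@complexI _)) expf_eq0 mulf_eq0 /=.
    have nz z : z \in [:: a; b] -> nrm z != 0.
      move=> zrs; have := spectrum_neq0 hS MA chA A0 zrs.
      by rewrite -normr_eq0 normCE -(rmorph0 (real_complex R)) (inj_eq (@complexI _)).
    by rewrite (negPf (nz _ ars)) (negPf (nz _ brs)).
  have : 1 <= (nrm a * nrm b) ^+ 2.
    have -> : (nrm a * nrm b) ^+ 2 = `|\det M|%N%:R.
      apply: (@complexI R); rewrite -dE rmorph_nat.
      rewrite -[RHS](_ : `|(\det M)%:~R : C| = _); last by rewrite -intr_norm -abszE.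
      by rewrite dE norm_real_complex (ger0_norm (sqr_ge0 (nrm a * nrm b))).
    by rewrite ler1n.
  have := nrm_ge0 a; have := nrm_ge0 b.
  case: (ltgtP (nrm a) 1) ra => // ha _; last by left.
  case: (ltgtP (nrm b) 1) rb => // hb _; last by right.
  by move=> b0 a0; rewrite leNgt exprn_ilt1 ?mulr_ge0 //; nra.
have [s1 [s2 [s1P s2P s12]]] := growth_rates ab1.
have [N1 N1P] := exprn_le_dist1 (nrm_ge0 a) ra s1P.
have [N2 N2P] := exprn_le_dist1 (nrm_ge0 b) rb s2P.
pose N := maxn 1 (maxn N1 N2).
have lowD n : (N <= n)%N -> ((s1 * s2) ^+ 2) ^+ n <= (D n)%:R.
  rewrite !geq_max => /and3P[n0 /N1P h1 /N2P h2].
  rewrite DE exprAC ler_pXn2r ?nnegrE ?mulr_ge0 ?exprn_ge0 ?nrm_ge0 ?mulr_ge0 //;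
    try by [case/andP: s1P | case/andP: s2P].
  rewrite exprMn ler_pM ?exprn_ge0 //; try by [case/andP: s1P | case/andP: s2P].
    by apply: le_trans h1 _; case/andP: (nrm_dist1 a n).
  by apply: le_trans h2 _; case/andP: (nrm_dist1 b n).
have s1' : 1 < (s1 * s2) ^+ 2 by rewrite exprn_egt1.
pose B : R := ((nrm a + 2) * (nrm b + 2)) ^+ 2.
have uppD n : (N <= n)%N -> (D n)%:R <= B ^+ n.
  rewrite !geq_max => /and3P[n0 _ _].
  have upp (z : C) : nrm (z ^+ n - 1) <= (nrm z + 2) ^+ n.
    have /andP[_ zn] := nrm_dist1 z n; apply: le_trans zn _.
    case: n n0 => // n _; have z0 := nrm_ge0 z.
    rewrite exprS [leRHS]exprS mulrDl lerD //.
      by rewrite ler_wpM2l // lerXn2r ?nnegrE ?addr_ge0 // lerDl.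
    have : 1 <= (nrm z + 2) ^+ n by apply: exprn_ege1; lra.
    lra.
  rewrite DE /B exprAC ler_pXn2r ?nnegrE ?exprn_ge0 ?mulr_ge0 ?addr_ge0 ?nrm_ge0 //.
  by rewrite exprMn ler_pM ?nrm_ge0.
have B1 : 1 < B.
  rewrite exprn_egt1 //; have := nrm_ge0 a; have := nrm_ge0 b; nra.
apply: (@exponential_from_bounds _ _ D _ B N 4 s1' B1) => // n Nn.
  by rewrite lowD // uppD.
have Dn0 : \det (M ^+ n - 1%:M) != 0.
  have : 0 < (D n)%:R :> R.
    by apply: lt_le_trans (lowD n Nn); rewrite exprn_gt0 // (lt_trans ltr01).
  by rewrite ltr0n absz_gt0.
split.
  exact: (det_le_nb_fix (lifts_iter n hA) (represents_expr n MA)).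
exact: (nb_fix_le (lifts_iter n hA) (represents_expr n MA)).
Qed.

Lemma endo_exprE (f : endo L) n : (f ^+ n : torus L -> torus L) = iter n f.
Proof.
apply/funext => x; elim: n => [|n IHn]; first by rewrite expr0.
by rewrite exprS iterS -IHn.
Qed.

Lemma endo_eq0 (f : endo L) : lifts f 0 -> f = 0.
Proof.
move=> f0; apply: val_inj; apply: (lifts_eq f0) => v.
by rewrite mulmx0 (raddf0 (toTorus L)).
Qed.

(** Eigenvalues on the unit circle come all together, and then as roots of
    unity; otherwise nothing obstructs the growth. *)
Lemma endo_dichotomy (f : endo L) : f != 0 ->
  exists A M (rs : seq C), [/\ lifts f A, represents L M A, (0 < size rs)%N,
    char_poly A = \prod_(z <- rs) ('X - z%:P) &
    (exists2 k, (0 < k)%N & f ^+ k = 1) \/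
    (all (fun z => `|z| != 1) rs /\ exponential_behaviour (fix_fun f))].
Proof.
move=> f0; have [A fA] := endo_lift f; have [M MA] := lifts_represented fA.
have A0 : A != 0 by apply: contraNneq f0 => A0; apply/eqP/endo_eq0; rewrite -A0.
have [rs chA] := closed_field_poly_normal (char_poly A : {poly C}).
rewrite (monicP (char_poly_monic A)) scale1r in chA.
have srs := size_spectrum chA; exists A, M, rs; split; rewrite ?srs //.
have [/hasP[w wrs /eqP w1]|none] := boolP (has (fun z => `|z| == 1) rs).
  left; have [k k0 Ak] := finite_order_of_unit_circle hS MA chA A0 wrs w1.
  exists k => //; apply: val_inj; rewrite /= endo_exprE.
  apply: (lifts_eq (lifts_iter k fA)) => v.
  by rewrite Ak mulmx1.
right; rewrite -all_predC in none; split=> //.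
case: rs chA srs none => [|a [|b []]] // chA _ /= /and3P[a1 b1 _].
exact: exponential_of_spectrum fA MA A0 chA a1 b1.
Qed.

Lemma periodic_of_finite_order (f : endo L) k : (0 < k)%N -> f ^+ k = 1 ->
  periodic_behaviour (fix_fun f).
Proof.
move=> k0 fk; exists k; split=> // n _; rewrite /fix_fun.
by rewrite -!endo_exprE exprD fk mulr1.
Qed.

(** Along indices congruent to 1 modulo the period and prime to [r], the
    function would be both constant and exponentially growing. *)
Lemma periodic_not_mixed (h : nat -> R) : periodic_behaviour h -> ~ mixed_behaviour h.
Proof.
move=> [p [p0 hp]] [r [g [r2 [A [B [N [A1 B1 gN]]]] hg]]].
have hpk k : h (1 + k * p)%N = h 1%N.
  elim: k => [|k IHk]; first by rewrite addn0.
  by rewrite mulSn addnCA addnC hp ?addn_gt0.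
have A0 : 0 < A := lt_trans ltr01 A1.
have VA : 0 <= A^-1 < 1 by rewrite invr_ge0 ltW //= invf_lt1.
have c0 : 0 < (`|h 1%N| + 1)^-1 by rewrite invr_gt0 ltr_pwDr.
have [K KP] := exprn_eventually_le VA c0.
(* [n] is 1 modulo [r] and modulo the period [p], and exceeds [N] and [K]. *)
pose n := (1 + (r * (N + K)) * p)%N.
have rn : (r %| n)%N = false.
  by rewrite /n -mulnA dvdn_addl ?dvdn_mulr // dvdn1 gtn_eqF.
have NKn : (N + K <= n)%N.
  by rewrite /n mulnAC mulnC leqW // leq_pmulr // muln_gt0 p0 (ltnW r2).
have Nn := leq_trans (leq_addr K N) NKn; have Kn := leq_trans (leq_addl N K) NKn.
have := gN n Nn; have := hg n isT; rewrite rn hpk => <- /andP[An _].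
have := KP n Kn; rewrite exprVn lef_pV2 ?posrE ?exprn_gt0 ?ltr_pwDr // => hA.
have := le_trans hA (le_trans An (ler_norm _)); rewrite gerDl.
by rewrite ler10.
Qed.

Lemma exponential_not_mixed (h : nat -> R) : exponential_behaviour h -> ~ mixed_behaviour h.
Proof.
move=> [A [B [N [A1 B1 hN]]]] [r [g [r2 _ hg]]].
have n0 : (0 < r * N.+1)%N by rewrite muln_gt0 (ltnW r2).
have := hg _ n0; rewrite dvdn_mulr // => h0.
have /hN/andP[] : (N <= r * N.+1)%N by nia.
rewrite h0 => A0 _; have := lt_le_trans (exprn_gt0 (r * N.+1) (lt_trans ltr01 A1)) A0.
by rewrite ltxx.
Qed.
End Dichotomy.

(** * Polynomial relations in the rational endomorphism algebra *)

Section RationalEndomorphisms.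
Variables (R : realType) (L : lattice R).
Local Notation C := (R[i] : numClosedFieldType).

Lemma endo_toQ_is_additive : zmod_morphism (@endo_toQ R L).
Proof.
move=> f g; apply/esym; rewrite /endo_toQ /toRatTensor.
rewrite -[LHS]/(rt_add _ (rt_opp _)) rt_pi_opp rt_pi_add; apply: rt_eq1.
by rewrite /= !mulr1n.
Qed.

HB.instance Definition _ := GRing.isZmodMorphism.Build (endo L) (endoQ L)
  (@endo_toQ R L) endo_toQ_is_additive.

Lemma endo_toQ_is_multiplicative : monoid_morphism (@endo_toQ R L).
Proof.
split=> // f g; apply/esym; rewrite /endo_toQ /toRatTensor.
by rewrite -[LHS]/(rt_mul _ _) rt_pi_mul; apply: rt_eq1.
Qed.

HB.instance Definition _ := GRing.isMonoidMorphism.Build (endo L) (endoQ L)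
  (@endo_toQ R L) endo_toQ_is_multiplicative.

Lemma lifts_zero : lifts (0 : endo L) 0.
Proof. by move=> v; rewrite mulmx0 (raddf0 (toTorus L)). Qed.

Lemma liftsMn (f : endo L) A n : lifts f A -> lifts (f *+ n) (A *+ n).
Proof.
move=> fA v; rewrite endo_mulrnE fA -(raddfMn (toTorus L)); congr (toTorus L _).
by rewrite raddfMn.
Qed.

(** The endomorphism ring is torsion-free, as it embeds into complex matrices. *)
Lemma endo_toQ_inj : injective (@endo_toQ R L).
Proof.
apply: raddf_inj => f /eqmodP/frac_equivP[k k0] /=.
rewrite mul0rn mul1n => fk; have [A fA] := endo_lift f.
have := lifts_inj (liftsMn k fA); rewrite fk => /(_ _ lifts_zero) /eqP.
rewrite -scaler_nat scaler_eq0 pnatr_eq0 -[k == 0%N]negbK -lt0n k0 /= => /eqP A0.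
by apply: endo_eq0; rewrite -A0.
Qed.

Lemma lifts_int (c : int) : lifts (c%:~R : endo L) (c%:~R%:M).
Proof.
have nat_case n : lifts (n%:R : endo L) (n%:R%:M).
  move=> v; rewrite endo_mulrnE mul_mx_scalar scaler_nat.
  by rewrite (raddfMn (toTorus L)).
case: c => n; first exact: nat_case.
move=> v; rewrite NegzE !mulrNz raddfN mulmxN (raddfN (toTorus L)).
transitivity (- (n.+1%:R : endo L) (toTorus L v)); first by [].
by rewrite nat_case.
Qed.

Lemma lifts_horner (f : endo L) A (q : {poly int}) : lifts f A ->
  lifts (map_poly intr q).[f] (horner_mx A (map_poly intr q)).
Proof.
move=> fA; elim/poly_ind: q => [|q c IHq].
  by rewrite !rmorph0 horner0; exact: lifts_zero.
rewrite !rmorphD !rmorphM /= !map_polyX !map_polyC /= hornerMXaddC.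
rewrite horner_mx_X horner_mx_C => v.
set Q := horner_mx A _ in IHq *.
have QA : Q * A = A * Q.
  by rewrite -[in LHS](horner_mx_X A) -[in RHS](horner_mx_X A) -!rmorphM mulrC.
transitivity ((map_poly intr q).[f] (f (toTorus L v)) + (c%:~R : endo L) (toTorus L v)).
  by [].
by rewrite lifts_int fA IHq QA mulmxDr mulmxA (raddfD (toTorus L)).
Qed.

Lemma map_poly_ratr_intr (q : {poly int}) :
  map_poly ratr (map_poly intr q) = map_poly intr q :> {poly C}.
Proof. by rewrite -map_poly_comp; apply: eq_map_poly => m; rewrite /= ratr_int. Qed.

Lemma horner_endo_eq0 (f : endo L) A (q : {poly int}) : lifts f A ->
  (map_poly intr q).[f] = 0 <-> horner_mx A (map_poly intr q) = 0.
Proof.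
move=> /(lifts_horner q) qA; split=> q0; move: qA; rewrite q0.
  by move=> /lifts_inj/(_ lifts_zero).
exact: endo_eq0.
Qed.

(** Rational polynomial relations can be checked on the matrix [A], after
    clearing denominators. *)
Lemma horner_alg_endo_eq0 (f : endo L) A (p : {poly rat}) : lifts f A ->
  horner_alg (endo_toQ f) p = 0 <-> horner_mx A (map_poly ratr p) = 0.
Proof.
move=> fA; have [q [a a0 ->]] := rat_poly_scale p.
have aC : (ratr (a%:~R)^-1 : C) != 0 by rewrite fmorph_eq0 invr_eq0 intr_eq0.
have aQ : (a%:~R)^-1 != 0 :> rat by rewrite invr_eq0 intr_eq0.
rewrite linearZ map_polyZ /= linearZ /= map_poly_ratr_intr.
have -> : horner_alg (endo_toQ f) (map_poly intr q) =
    endo_toQ (map_poly intr q).[f].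
  rewrite -horner_map /= -map_poly_comp /horner_alg /horner_morph -map_poly_comp.
  congr (_.[_]); apply: eq_map_poly => m /=; rewrite rmorph_int.
  by rewrite scaler_int.
have scal0 (K : fieldType) (W : lmodType K) (e : K) (w : W) : e != 0 ->
    e *: w = 0 <-> w = 0.
  by move=> e0; split=> [/eqP|->]; rewrite ?scaler0 // scaler_eq0 (negPf e0) => /eqP.
rewrite mulr_algl scal0 // scal0 // -(horner_endo_eq0 _ fA).
split=> [|->]; rewrite ?raddf0 //.
by rewrite -[0 in X in X -> _](raddf0 (@endo_toQ R L)) => /endo_toQ_inj.
Qed.
End RationalEndomorphisms.

(** * Quaternion algebras and embeddings *)

Section QuaternionCase.
Variables (R : realType) (L : lattice R) (alpha beta : rat) (i j : endoQ L).
Hypothesis quat : quaternion_multiplication alpha beta i j.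

Lemma sqrrD_anticomm (u v : endoQ L) : u * v = - (v * u) ->
  (u + v) ^+ 2 = u ^+ 2 + v ^+ 2.
Proof.
by move=> uv; rewrite expr2 mulrDl !mulrDr uv -!expr2 addrA addrNK.
Qed.

(** [b i + c j + d ij] is a sum of three pairwise anticommuting elements, so its
    square is the sum of their squares. *)
Lemma quat_comb_quadratic a b c d :
  (quat_comb i j a b c d - a *: 1) ^+ 2 =
  (b ^+ 2 * alpha + c ^+ 2 * beta - d ^+ 2 * alpha * beta) *: 1.
Proof.
have [_ [i2 j2 ij] _ _] := quat; have ji : j * i = - (i * j) by rewrite ij opprK.
have -> : quat_comb i j a b c d - a *: 1 = (b *: i + c *: j) + d *: (i * j).
  by rewrite /quat_comb -!addrA addrC -!addrA addNr addr0.
have ik : i * (i * j) = alpha *: j by rewrite mulrA -expr2 i2 mulr_algl.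
have ki : i * j * i = - (alpha *: j) by rewrite -mulrA ji mulrN ik.
have kj : i * j * j = beta *: i by rewrite -mulrA -expr2 j2 mulr_algr.
have jk : j * (i * j) = - (beta *: i) by rewrite mulrA ji mulNr kj.
have kk : (i * j) ^+ 2 = - (alpha * beta) *: 1.
  by rewrite expr2 mulrA ki mulNr -scalerAl -expr2 j2 scalerA scaleNr.
rewrite !sqrrD_anticomm.
- rewrite !expr2 -!scalerAl -!scalerAr -!expr2 i2 j2 kk !scalerA -!scalerDl.
  by congr (_ *: _); ring.
- by rewrite -!scalerAl -!scalerAr ij !scalerN !scalerA mulrC.
rewrite mulrDl mulrDr -!scalerAl -!scalerAr ik jk ki kj.
by rewrite !scalerN !scalerA opprD opprK !(mulrC d).
Qed.

Lemma quat_comb_scalar a b c d e : quat_comb i j a b c d = e *: 1 ->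
  [/\ a = e, b = 0, c = 0 & d = 0].
Proof.
move=> xe; have [_ _ _ free] := quat.
have [|/subr0_eq ae b0 c0 d0] := free (a - e) b c d; last by split.
rewrite /quat_comb -!addrA in xe *.
by rewrite scalerBl -addrA addrCA xe addNr.
Qed.
End QuaternionCase.

Lemma norm_spectrum_of_finite_order (R : realType) (L : lattice R) (f : endo L)
    (A : 'M[R[i]]_2) (rs : seq R[i]) k w : lifts f A ->
  char_poly A = \prod_(z <- rs) ('X - z%:P) ->
  (0 < k)%N -> f ^+ k = 1 -> w \in rs -> `|w| = 1.
Proof.
move=> fA chA k0 fk wrs; have Ak : A ^+ k = 1.
  have := lifts_iter k fA; rewrite -endo_exprE fk => /lifts_inj; apply => v.
  by rewrite mulmx1.
have : horner_mx A ('X^k - 1) = 0.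
  by rewrite rmorphB rmorphXn /= horner_mx_X Ak rmorph1 subrr.
move=> /(horner_mx0_spectrum chA)/(_ wrs); rewrite rootE !hornerE subr_eq0 => /eqP wk.
by apply/eqP; rewrite -(pexpr_eq1 k0 (normr_ge0 _)) -normrX wk normr1.
Qed.

(** The characteristic polynomial of [M] annihilates [f], so [sigma f] is one of
    its roots: an eigenvalue of [A] or the conjugate of one. *)
Lemma norm_rmorph_spectrum (R : realType) (L : lattice R) (hS : simple_surface L)
    (f : endo L) (A : 'M[R[i]]_2) M (rs : seq R[i]) : lifts f A ->
  represents L M A -> (0 < size rs)%N ->
  char_poly A = \prod_(z <- rs) ('X - z%:P) ->
  forall sigma : {rmorphism endo L -> R[i]},
    exists2 y, y \in rs & `|sigma f| = `|y|.
Proof.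
move=> fA MA rs0 chA sigma; pose q := char_poly M.
have qE : map_poly ratr (map_poly intr q) = map_poly intr q :> {poly R[i]}.
  exact: map_poly_ratr_intr.
have qM : map_poly intr q =
    \prod_(z <- rs ++ map Num.conj rs) ('X - z%:P) :> {poly R[i]}.
  by rewrite -qE map_char_poly (map_char_poly_represents MA chA).
have [w wrs] : exists w, w \in rs.
  by case: (rs) rs0 => // w ? _; exists w; rewrite mem_head.
have qf : (map_poly intr q).[f] = 0.
  apply/(horner_endo_eq0 _ fA); rewrite -qE.
  apply: (horner_mx0_of_root hS MA chA wrs).
  by rewrite qE qM root_prod_XsubC mem_cat wrs.
have : root (map_poly intr q : {poly R[i]}) (sigma f).
  rewrite rootE; have <- : map_poly sigma (map_poly intr q) = map_poly intr q.
    by rewrite -map_poly_comp; apply: eq_map_poly => m; rewrite /= rmorph_int.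
  by rewrite horner_map qf rmorph0.
rewrite qM root_prod_XsubC mem_cat => /orP[sr|/mapP[y yrs ->]].
  by exists (sigma f).
by exists y => //; rewrite norm_conjC.
Qed.

Lemma real_unit_norm (C : numClosedFieldType) (x : C) : x \is Num.real -> `|x| = 1 ->
  exists e : int, x = e%:~R.
Proof.
move=> xr x1; have : x ^+ 2 == 1 by rewrite -real_normK // x1 expr1n.
by rewrite sqrf_eq1 => /orP[]/eqP ->; [exists 1 | exists (-1)].
Qed.

Theorem theorem2 (R : realType) (L : lattice R)
    (hA : abelian_surface L) (hS : simple_surface L) :
  [/\ forall f : endo L, f != 0 ->
        (exponential_behaviour (fix_fun f) \/ periodic_behaviour (fix_fun f)) /\
        ~ mixed_behaviour (fix_fun f),

      forall d : nat, (0 < d)%N -> squarefree d -> real_multiplication L d ->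
        forall f : endo L, f != 0 ->
          (f = 1 \/ f = - 1 -> periodic_behaviour (fix_fun f)) /\
          (~ (f = 1 \/ f = - 1) -> exponential_behaviour (fix_fun f)),

      forall (alpha beta : rat) (i j : endoQ L),
        quaternion_multiplication alpha beta i j ->
        0 < alpha -> beta <= alpha ->
        forall (f : endo L) (a b c d : rat), f != 0 ->
          endo_toQ f = quat_comb i j a b c d ->
          let z : R[i] := ratr a + sqrtC (ratr
            (b ^+ 2 * alpha + c ^+ 2 * beta - d ^+ 2 * alpha * beta)) in
          (`|z| = 1 -> periodic_behaviour (fix_fun f)) /\
          (`|z| <> 1 -> exponential_behaviour (fix_fun f))

    & complex_multiplication L ->
        forall sigma : {rmorphism endo L -> R[i]}, injective sigma ->
        forall f : endo L, f != 0 ->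
          (`|sigma f| = 1 -> periodic_behaviour (fix_fun f)) /\
          (`|sigma f| <> 1 -> exponential_behaviour (fix_fun f))].
Proof.
split.
- move=> f /(endo_dichotomy hS)[A [M [rs [_ _ _ _ [[k k0 fk]|[_ fexp]]]]]].
    have fper := periodic_of_finite_order k0 fk.
    by split; [right | exact: periodic_not_mixed].
  by split; [left | exact: exponential_not_mixed].
- move=> d _ _ [phi [phi_inj _]] f f0; split=> [f1|f1].
    apply: (@periodic_of_finite_order _ _ f 2) => //.
    by case: f1 => ->; rewrite ?expr1n // sqrrN expr1n.
  have [A [M [rs [_ _ _ _ [[k k0 fk]|[_ //]]]]]] := endo_dichotomy hS f0.
  case: f1; have phik : `|phi (endo_toQ f)| ^+ k = 1.
    by rewrite -normrX -!rmorphXn fk !rmorph1 normr1.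
  have : phi (endo_toQ f) ^+ 2 == 1.
    rewrite -real_normK ?num_real //.
    by move/eqP: phik; rewrite pexpr_eq1 // => /eqP ->; rewrite expr1n.
  rewrite sqrf_eq1 => /orP[]/eqP fE; [left|right];
    by apply/(@endo_toQ_inj R L)/phi_inj; rewrite fE ?rmorphN !rmorph1.
- move=> alpha beta i j quat _ _ f a b c d f0 fE z.
  have [A [M [rs [fA MA rs0 chA dich]]]] := endo_dichotomy hS f0.
  pose disc := b ^+ 2 * alpha + c ^+ 2 * beta - d ^+ 2 * alpha * beta.
  have ratr_real x : (ratr x : R[i]) \is Num.real.
    by rewrite realE ler0q lerq0 le_total.
  pose s : R[i] := sqrtC (ratr disc).
  have s2 : s ^+ 2 = ratr disc by rewrite sqrtCK.
  have [w wrs] : exists w, w \in rs.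
    by case: (rs) rs0 => // w ? _; exists w; rewrite mem_head.
  have w_root : w - ratr a = s \/ w - ratr a = - s.
    have : horner_alg (endo_toQ f) (('X - a%:P) ^+ 2 - disc%:P) = 0.
      rewrite rmorphB rmorphXn rmorphB /= horner_algX !horner_algC.
      by rewrite fE (quat_comb_quadratic quat) subrr.
    move/(horner_alg_endo_eq0 _ fA)/(horner_mx0_spectrum chA)/(_ wrs).
    rewrite rmorphB rmorphXn rmorphB /= map_polyX !map_polyC /=.
    rewrite rootE !hornerE -s2 subr_eq0 eqf_sqr => /orP[]/eqP ->; auto.
  (* A rational eigenvalue makes [f] a scalar, and then [s = 0]. *)
  have rational_eigenvalue e : w = ratr e -> z = w.
    move=> we; have : horner_alg (endo_toQ f) ('X - e%:P) = 0.
      apply/(horner_alg_endo_eq0 _ fA)/(horner_mx0_of_root hS MA chA wrs).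
      by rewrite rmorphB /= map_polyX map_polyC /= rootE !hornerE we subrr.
    rewrite rmorphB /= horner_algX horner_algC fE => /subr0_eq.
    move=> /(quat_comb_scalar quat)[ae b0 c0 d0].
    by rewrite we /z ae b0 c0 d0 !expr0n !mul0r addr0 subr0 rmorph0 sqrtC0 addr0.
  have [disc_neg|disc_ge0] := ltP disc 0.
    have zw : `|z| = `|w|.
      (* [s] is a square root of a negative number. *)
      have sc : s^* = - s.
        have : s^* ^+ 2 == s ^+ 2.
          by rewrite -rmorphXn s2 /= conj_Creal ?ratr_real.
        rewrite eqf_sqr => /orP[/eqP sr|/eqP //].
        have : 0 <= s ^+ 2 by rewrite expr2 -{2}sr mul_conjC_ge0.
        by rewrite s2 ler0q leNgt disc_neg.
      rewrite (_ : z = ratr a + s) //; case: w_root => /(canRL (subrK _)) ->.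
        by rewrite addrC.
      by rewrite -[RHS]norm_conjC rmorphD rmorphN /= sc opprK conj_Creal // addrC.
    rewrite zw; case: dich => [[k k0 fk]|[/allP/(_ w wrs)/eqP w1 fexp]]; split=> //.
        by move=> _; exact: periodic_of_finite_order k0 fk.
    by case; exact: norm_spectrum_of_finite_order fA chA k0 fk wrs.
  (* From here on [s], [w] and [z] are real, so that absolute value 1 means
     being 1 or -1, hence rational. *)
  have s_real : s \is Num.real by rewrite ger0_real // sqrtC_ge0 ler0q.
  have w_real : w \is Num.real.
    case: w_root => /(canRL (subrK _)) ->; rewrite rpredD ?rpredN //;
      exact: ratr_real.
  case: dich => [[k k0 fk]|[/allP/(_ w wrs)/eqP w1 fexp]]; split=> //.
  + by move=> _; exact: periodic_of_finite_order k0 fk.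
  + case; have w1 := norm_spectrum_of_finite_order fA chA k0 fk wrs.
    have [e we] := real_unit_norm w_real w1.
    by rewrite (rational_eigenvalue e%:~R) // ratr_int.
  move=> z1; case: w1; have zr : z \is Num.real by rewrite rpredD ?ratr_real.
  have [e ze] := real_unit_norm zr z1.
  have se : s = ratr (e%:~R - a).
    by rewrite rmorphB /= ratr_int -ze /z addrC addKr.
  case: w_root => /(canRL (subrK _)) wE.
    by rewrite -(rational_eigenvalue (e%:~R - a + a)) // rmorphD /= -se.
  by rewrite -(rational_eigenvalue (- (e%:~R - a) + a)) // rmorphD rmorphN /= -se.
- move=> _ sigma _ f f0.
  have [A [M [rs [fA MA rs0 chA dich]]]] := endo_dichotomy hS f0.
  case: dich => [[k k0 fk]|[/allP rs1 fexp]]; split=> //.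
  + by move=> _; exact: periodic_of_finite_order k0 fk.
  + case; apply/eqP; rewrite -(pexpr_eq1 k0 (normr_ge0 _)).
    by rewrite -normrX -rmorphXn fk rmorph1 normr1.
  have [y yrs yE] := norm_rmorph_spectrum hS fA MA rs0 chA sigma.
  move=> sf1; exfalso.
  by have /eqP := rs1 y yrs; rewrite -yE sf1.
Qed.
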